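(* If the Boolean Ultrafilter Theorem holds, then the dual equivalence between the category $\mathbf{StKSp}$ of stably compact spaces and the category $\mathbf{StKFrm}$ of stably compact frames (given by the restrictions of $\mathcal{O}$ and $\Sigma$) reduces (restricts) to a dual equivalence between the category $\mathbf{KHaus}$ of compact Hausdorff spaces and continuous maps and the category $\mathbf{KRegFrm}$ of compact regular frames and frame homomorphisms, these being, respectively, the category of algebras of $R\cdot F$ and the category of coalgebras of $CReg\cdot\mathfrak{I}$.
   Context: The Boolean Ultrafilter Theorem: every proper filter of a Boolean algebra is contained in an ultrafilter. $\mathcal{O}:\mathbf{Top}\to\mathbf{Frm}^{op}$ is the open-set functor, and $\Sigma:\mathbf{Frm}^{op}\to\mathbf{Top}$ its right adjoint, the spectrum: $\Sigma L$ is the set of frame homomorphisms $f:L\to 2$ with open sets $\Sigma_a=\{f\mid f(a)=1\}$. On a frame $L$, $a\ll b$ means: for every $S\subseteq L$ with $b\le\bigvee S$ there is a finite $G\subseteq S$ with $a\le\bigvee G$. A frame is stably compact if $\ll$ is a sublattice of $L\times L$ (so $1\ll1$) and $a=\bigvee\{x\mid x\ll a\}$ for all $a$. A stably compact space is a compact, locally compact, sober space $X$ with $\ll$ a sublattice of $\mathcal{O}X\times\mathcal{O}X$. Morphisms of $\mathbf{StKFrm}$ are proper frame homomorphisms (those preserving $\ll$); morphisms of $\mathbf{StKSp}$ are proper maps (continuous maps $f$ with $f^{-1}[-]$ preserving $\ll$). $F:\mathbf{Top}\to\mathbf{Top}$ is the open prime filter functor: $FX$ is the set of prime filters of the lattice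 of open sets of $X$, with basic open sets $O^{*}=\{p\in FX\mid O\in p\}$, $O$ open in $X$. $\mathfrak{I}:\mathbf{Frm}\to\mathbf{Frm}$ is the ideal functor, $\mathfrak{I}L$ being the frame of ideals of $L$. $R:\mathbf{Top}\to\mathbf{Top}$ is the Hausdorff reflector, and $CReg:\mathbf{Frm}\to\mathbf{Frm}$ is the completely regular coreflector. The composite $R\cdot F$ is the Čech–Stone compactification reflector on $\mathbf{Top}$ (regarded as an idempotent monad), and $CReg\cdot\mathfrak{I}$ is the pointfree Čech–Stone compactification coreflector on $\mathbf{Frm}$ (regarded as an idempotent comonad). *)

(* Defs.v *)
From HB Require Import structures.
From mathcomp Require Import all_boot all_order all_algebra all_classical.
From mathcomp Require Import topology lra.

Set Implicit Arguments.
Unset Strict Implicit.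
Unset Printing Implicit Defensive.

Import Order.TTheory GRing.Theory Num.Theory.

Local Open Scope classical_set_scope.
Local Open Scope order_scope.

Record category := Category {
  obj :> Type;
  arr : obj -> obj -> Type;
  id_arr : forall A, arr A A;
  compm : forall A B C, arr B C -> arr A B -> arr A C;
  comp1m : forall A B (f : arr A B), compm (id_arr B) f = f;
  compm1 : forall A B (f : arr A B), compm f (id_arr A) = f;
  compmA : forall A B C D (h : arr C D) (g : arr B C) (f : arr A B),
    compm h (compm g f) = compm (compm h g) f }.

Arguments arr {c}.
Arguments id_arr {c}.
Arguments compm {c A B C}.
Notation "g '\oc' f" := (compm g f) (at level 50, left associativity).

Definition is_iso (C : category) (A B : C) (f : arr A B) : Prop :=
  exists g : arr B A, g \oc f = id_arr A /\ f \oc g = id_arr B.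

Definition op_cat (C : category) : category :=
  @Category C (fun A B => @arr C B A) (fun A => id_arr A)
    (fun _ _ _ g f => f \oc g)
    (fun _ _ f => compm1 f) (fun _ _ f => comp1m f)
    (fun _ _ _ _ h g f => esym (compmA f g h)).

Record functor (C D : category) := Functor {
  fobj :> C -> D;
  fun_arr : forall A B, arr A B -> arr (fobj A) (fobj B);
  fmap1 : forall A, fun_arr (id_arr A) = id_arr (fobj A);
  fmapM : forall A B E (g : arr B E) (f : arr A B),
    fun_arr (g \oc f) = fun_arr g \oc fun_arr f }.

Arguments fun_arr {C D} _ {A B}.

Definition id_functor (C : category) : functor C C :=
  @Functor C C id (fun _ _ f => f) (fun=> erefl) (fun _ _ _ _ _ => erefl).

Section CompFunctor.
Variables (C D E : category) (G : functor D E) (F : functor C D).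

Let comp_fmap1 A : fun_arr G (fun_arr F (id_arr A)) = id_arr (G (F A)).
Proof. by rewrite !fmap1. Qed.

Let comp_fmapM A B X (g : arr B X) (f : arr A B) :
  fun_arr G (fun_arr F (g \oc f)) = fun_arr G (fun_arr F g) \oc fun_arr G (fun_arr F f).
Proof. by rewrite !fmapM. Qed.

Definition comp_functor : functor C E :=
  @Functor C E (fun A => G (F A)) (fun A B f => fun_arr G (fun_arr F f))
    comp_fmap1 comp_fmapM.
End CompFunctor.

Notation "G '\of' F" := (comp_functor G F) (at level 50, left associativity).

(* Equality of arrows whose endpoints need not be convertible. *)
Inductive arr_eq (C : category) (A B : C) (f : arr A B) :
    forall A' B' : C, arr A' B' -> Prop :=
  ArrEq : arr_eq f f.

Definition functor_eq (C D : category) (F G : functor C D) : Prop :=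
  forall (A B : C) (f : arr A B), arr_eq (fun_arr F f) (fun_arr G f).

Record nat_trans (C D : category) (F G : functor C D) := NatTrans {
  component :> forall A, arr (F A) (G A);
  naturality : forall A B (f : arr A B),
    component B \oc fun_arr F f = fun_arr G f \oc component A }.

Definition is_nat_iso (C D : category) (F G : functor C D)
  (t : nat_trans F G) : Prop := forall A, is_iso (t A).

Record adjunction (C D : category) (F : functor C D) (G : functor D C) :=
  Adjunction {
    adj_unit : nat_trans (id_functor C) (G \of F);
    adj_counit : nat_trans (F \of G) (id_functor D);
    triangleL : forall A, adj_counit (F A) \oc fun_arr F (adj_unit A) = id_arr (F A);
    triangleR : forall B, fun_arr G (adj_counit B) \oc adj_unit (G B) = id_arr (G B) }.

(* [A] and [B], as categories over [E], are isomorphic on the nose; taking for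
   [U] a forgetful functor and for [V] the inclusion of a subcategory, this says
   that the subcategory is the category of (co)algebras. *)
Definition iso_over (A B E : category) (U : functor A E) (V : functor B E)
    : Prop :=
  exists (G : functor A B) (H : functor B A),
    [/\ functor_eq (H \of G) (id_functor A),
        functor_eq (G \of H) (id_functor B) & functor_eq (V \of G) U].

Record subcategory (C : category) := Subcategory {
  sub_ob : C -> Prop;
  sub_hom : forall A B : C, arr A B -> Prop;
  sub_idm : forall A, sub_ob A -> sub_hom (id_arr A);
  sub_comp : forall (A B E : C) (g : arr B E) (f : arr A B),
    sub_ob A -> sub_ob B -> sub_ob E ->
    sub_hom g -> sub_hom f -> sub_hom (g \oc f) }.

Definition full_sub (C : category) (P : C -> Prop) : subcategory C :=
  @Subcategory C P (fun _ _ _ => True) (fun _ _ => I)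
    (fun _ _ _ _ _ _ _ _ _ _ => I).

Definition subcategory_of (C : category) (S T : subcategory C) : Prop :=
  (forall A, sub_ob S A -> sub_ob T A) /\
  (forall A B (f : arr A B), sub_ob S A -> sub_ob S B ->
     sub_hom S f -> sub_hom T f).

Definition op_sub (C : category) (S : subcategory C) :
    subcategory (op_cat C) :=
  @Subcategory (op_cat C) (sub_ob S) (fun A B f => @sub_hom C S B A f)
    (@sub_idm _ S)
    (fun _ _ _ _ _ SA SB SE Sg Sf => @sub_comp _ S _ _ _ _ _ SE SB SA Sf Sg).

Section CatOfSub.
Variables (C : category) (S : subcategory C).

Definition sub_obj := {A : C | sub_ob S A}.
Definition sub_arr (A B : sub_obj) :=
  {f : arr (sval A) (sval B) | sub_hom S f}.

Lemma sub_arr_eq A B (f g : sub_arr A B) : sval f = sval g -> f = g.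
Proof. by case: f g => [f Sf] [g Sg] /= fg; apply: eq_exist. Qed.

Definition sub_cat : category.
Proof.
refine (@Category sub_obj sub_arr
  (fun A => exist _ (id_arr (sval A)) (sub_idm (svalP A)))
  (fun A B E g f => exist _ (sval g \oc sval f)
     (sub_comp (svalP A) (svalP B) (svalP E) (svalP g) (svalP f))) _ _ _).
- by move=> A B f; apply: sub_arr_eq; apply: comp1m.
- by move=> A B f; apply: sub_arr_eq; apply: compm1.
- by move=> A B E D h g f; apply: sub_arr_eq; apply: compmA.
Defined.

Definition sub_incl : functor sub_cat C :=
  @Functor sub_cat C (fun A => sval A) (fun _ _ f => sval f)
    (fun=> erefl) (fun _ _ _ _ _ => erefl).
End CatOfSub.

Definition maps_sub (C D : category) (F : functor C D)
    (S : subcategory C) (T : subcategory D) : Prop :=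
  (forall A, sub_ob S A -> sub_ob T (F A)) /\
  (forall A B (f : arr A B), sub_ob S A -> sub_ob S B ->
     sub_hom S f -> sub_hom T (fun_arr F f)).

Section Restrict.
Variables (C D : category) (F : functor C D).
Variables (S : subcategory C) (T : subcategory D) (FST : maps_sub F S T).

Definition restrict_functor : functor (sub_cat S) (sub_cat T).
Proof.
refine (@Functor (sub_cat S) (sub_cat T)
  (fun A => exist _ (F (sval A)) (FST.1 _ (svalP A)))
  (fun A B f => exist _ (fun_arr F (sval f))
     (FST.2 _ _ _ (svalP A) (svalP B) (svalP f))) _ _).
- by move=> A; apply: sub_arr_eq; apply: fmap1.
- by move=> A B E g f; apply: sub_arr_eq; apply: fmapM.
Defined.
End Restrict.

(* The adjoint functors [F] and [G] restrict to mutually inverse equivalences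
   of [S] and [T], by means of the restricted unit and counit. *)
Definition restricts_to_equivalence (C D : category) (F : functor C D)
    (G : functor D C) (adj : adjunction F G)
    (S : subcategory C) (T : subcategory D) : Prop :=
  exists (FST : maps_sub F S T) (GTS : maps_sub G T S)
    (eta : nat_trans (id_functor (sub_cat S))
       (restrict_functor GTS \of restrict_functor FST))
    (eps : nat_trans (restrict_functor FST \of restrict_functor GTS)
       (id_functor (sub_cat T))),
    [/\ forall A, sval (eta A) = adj_unit adj (sval A),
        forall B, sval (eps B) = adj_counit adj (sval B),
        is_nat_iso eta & is_nat_iso eps].

Record monad (C : category) (T : functor C C)
    (eta : nat_trans (id_functor C) T) := Monad {
  mon_mult : nat_trans (T \of T) T;
  mult_unitl : forall A, mon_mult A \oc eta (T A) = id_arr (T A);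
  mult_unitr : forall A, mon_mult A \oc fun_arr T (eta A) = id_arr (T A);
  multA : forall A,
    mon_mult A \oc fun_arr T (mon_mult A) = mon_mult A \oc mon_mult (T A) }.

Record comonad (C : category) (T : functor C C)
    (eps : nat_trans T (id_functor C)) := Comonad {
  com_comult : nat_trans T (T \of T);
  comult_counitl : forall A, eps (T A) \oc com_comult A = id_arr (T A);
  comult_counitr : forall A, fun_arr T (eps A) \oc com_comult A = id_arr (T A);
  comultA : forall A,
    fun_arr T (com_comult A) \oc com_comult A
    = com_comult (T A) \oc com_comult A }.

Section Algebras.
Variables (C : category) (T : functor C C).
Variables (eta : nat_trans (id_functor C) T) (M : monad eta).

Record algebra := Algebra {
  alg_ob : C;
  alg_str : arr (T alg_ob) alg_ob;
  alg_unit : alg_str \oc eta alg_ob = id_arr alg_ob;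
  alg_mult : alg_str \oc fun_arr T alg_str = alg_str \oc mon_mult M alg_ob }.

Definition alg_hom (A B : algebra) :=
  {f : arr (alg_ob A) (alg_ob B) | f \oc alg_str A = alg_str B \oc fun_arr T f}.

Lemma alg_hom_eq A B (f g : alg_hom A B) : sval f = sval g -> f = g.
Proof. by case: f g => [f Sf] [g Sg] /= fg; apply: eq_exist. Qed.

Let alg_id_subproof (A : algebra) :
  id_arr (alg_ob A) \oc alg_str A = alg_str A \oc fun_arr T (id_arr (alg_ob A)).
Proof. by rewrite fmap1 comp1m compm1. Qed.

Let alg_comp_subproof (A B E : algebra) (g : alg_hom B E) (f : alg_hom A B) :
  (sval g \oc sval f) \oc alg_str A
  = alg_str E \oc fun_arr T (sval g \oc sval f).
Proof. by rewrite fmapM compmA -(svalP g) -!compmA (svalP f). Qed.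

Definition alg_cat : category.
Proof.
refine (@Category algebra alg_hom
  (fun A => exist _ _ (alg_id_subproof A))
  (fun A B E g f => exist _ _ (alg_comp_subproof g f)) _ _ _).
- by move=> A B f; apply: alg_hom_eq; apply: comp1m.
- by move=> A B f; apply: alg_hom_eq; apply: compm1.
- by move=> A B E D h g f; apply: alg_hom_eq; apply: compmA.
Defined.

Definition alg_forget : functor alg_cat C :=
  @Functor alg_cat C alg_ob (fun _ _ f => sval f)
    (fun=> erefl) (fun _ _ _ _ _ => erefl).

Definition idempotent_monad : Prop := is_nat_iso (mon_mult M).
End Algebras.

Section Coalgebras.
Variables (C : category) (T : functor C C).
Variables (eps : nat_trans T (id_functor C)) (W : comonad eps).

Record coalgebra := Coalgebra {
  coalg_ob : C;
  coalg_str : arr coalg_ob (T coalg_ob);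
  coalg_counit : eps coalg_ob \oc coalg_str = id_arr coalg_ob;
  coalg_comult :
    fun_arr T coalg_str \oc coalg_str = com_comult W coalg_ob \oc coalg_str }.

Definition coalg_hom (A B : coalgebra) :=
  {f : arr (coalg_ob A) (coalg_ob B)
     | coalg_str B \oc f = fun_arr T f \oc coalg_str A}.

Lemma coalg_hom_eq A B (f g : coalg_hom A B) : sval f = sval g -> f = g.
Proof. by case: f g => [f Sf] [g Sg] /= fg; apply: eq_exist. Qed.

Let coalg_id_subproof (A : coalgebra) :
  coalg_str A \oc id_arr (coalg_ob A) = fun_arr T (id_arr (coalg_ob A)) \oc coalg_str A.
Proof. by rewrite fmap1 comp1m compm1. Qed.

Let coalg_comp_subproof (A B E : coalgebra)
    (g : coalg_hom B E) (f : coalg_hom A B) :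
  coalg_str E \oc (sval g \oc sval f)
  = fun_arr T (sval g \oc sval f) \oc coalg_str A.
Proof. by rewrite fmapM compmA (svalP g) -!compmA (svalP f). Qed.

Definition coalg_cat : category.
Proof.
refine (@Category coalgebra coalg_hom
  (fun A => exist _ _ (coalg_id_subproof A))
  (fun A B E g f => exist _ _ (coalg_comp_subproof g f)) _ _ _).
- by move=> A B f; apply: coalg_hom_eq; apply: comp1m.
- by move=> A B f; apply: coalg_hom_eq; apply: compm1.
- by move=> A B E D h g f; apply: coalg_hom_eq; apply: compmA.
Defined.

Definition coalg_forget : functor coalg_cat C :=
  @Functor coalg_cat C coalg_ob (fun _ _ f => sval f)
    (fun=> erefl) (fun _ _ _ _ _ => erefl).

Definition idempotent_comonad : Prop := is_nat_iso (com_comult W).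
End Coalgebras.

Section CompUnit.
Variables (C : category) (S T : functor C C).

Definition comp_unit (etaS : nat_trans (id_functor C) S)
    (etaT : nat_trans (id_functor C) T) :
  nat_trans (id_functor C) (S \of T).
Proof.
refine (@NatTrans C C (id_functor C) (S \of T)
  (fun A => etaS (T A) \oc etaT A) _).
move=> A B f /=; rewrite compmA -(naturality etaS (fun_arr T f)) /=.
by rewrite -!compmA -(naturality etaT f).
Defined.

Definition comp_counit (epsS : nat_trans S (id_functor C))
    (epsT : nat_trans T (id_functor C)) :
  nat_trans (S \of T) (id_functor C).
Proof.
refine (@NatTrans C C (S \of T) (id_functor C)
  (fun A => epsT A \oc epsS (T A)) _).
move=> A B f /=; rewrite compmA -(naturality epsT f) /=.
by rewrite -!compmA -(naturality epsS (fun_arr T f)).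
Defined.
End CompUnit.

Record reflection (C : category) (P : C -> Prop) := Reflection {
  refl_ob : C -> C;
  refl_ob_in : forall A, P (refl_ob A);
  refl_unit : forall A, arr A (refl_ob A);
  refl_ext : forall A B, P B -> arr A B -> arr (refl_ob A) B;
  refl_extE : forall A B (PB : P B) (f : arr A B),
    refl_ext PB f \oc refl_unit A = f;
  refl_ext_uniq : forall A B (PB : P B) (f : arr A B) (g : arr (refl_ob A) B),
    g \oc refl_unit A = f -> g = refl_ext PB f }.

Section Reflector.
Variables (C : category) (P : C -> Prop) (r : reflection P).

Definition reflector : functor C C.
Proof.
refine (@Functor C C (refl_ob r)
  (fun A B f => refl_ext r (refl_ob_in r B) (refl_unit r B \oc f)) _ _).
- by move=> A; apply/esym/refl_ext_uniq; rewrite comp1m compm1.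
- move=> A B E g f; apply/esym/refl_ext_uniq.
  by rewrite -compmA refl_extE compmA refl_extE compmA.
Defined.

Definition reflector_unit : nat_trans (id_functor C) reflector :=
  @NatTrans C C (id_functor C) reflector (refl_unit r)
    (fun _ _ _ => esym (refl_extE r _ _)).
End Reflector.

Record coreflection (C : category) (P : C -> Prop) := Coreflection {
  corefl_ob : C -> C;
  corefl_ob_in : forall A, P (corefl_ob A);
  corefl_counit : forall A, arr (corefl_ob A) A;
  corefl_lift : forall B A, P B -> arr B A -> arr B (corefl_ob A);
  corefl_liftE : forall B A (PB : P B) (f : arr B A),
    corefl_counit A \oc corefl_lift PB f = f;
  corefl_lift_uniq : forall B A (PB : P B) (f : arr B A)
    (g : arr B (corefl_ob A)),
    corefl_counit A \oc g = f -> g = corefl_lift PB f }.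

Section Coreflector.
Variables (C : category) (P : C -> Prop) (r : coreflection P).

Definition coreflector : functor C C.
Proof.
refine (@Functor C C (corefl_ob r)
  (fun A B f => corefl_lift r (corefl_ob_in r A) (f \oc corefl_counit r A)) _ _).
- by move=> A; apply/esym/corefl_lift_uniq; rewrite comp1m compm1.
- move=> A B E g f; apply/esym/corefl_lift_uniq.
  by rewrite compmA corefl_liftE -compmA corefl_liftE compmA.
Defined.

Definition coreflector_counit : nat_trans coreflector (id_functor C) :=
  @NatTrans C C coreflector (id_functor C) (corefl_counit r)
    (fun _ _ _ => corefl_liftE r _ _).
End Coreflector.

HB.mixin Record isFrame d T of Order.TBDistrLattice d T := {
  fsup : set T -> T;
  fsup_ub : forall (S : set T) x, S x -> x <= fsup S;
  fsup_least : forall (S : set T) a, (forall x, S x -> x <= a) -> fsup S <= a;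
  meet_fsup : forall a (S : set T),
    a `&` fsup S = fsup [set a `&` x | x in S] }.

#[short(type="frameType")]
HB.structure Definition Frame d :=
  { T of Order.TBDistrLattice d T & isFrame d T }.

Lemma fsup_leP d (L : frameType d) (S : set L) a :
  fsup S <= a <-> (forall x, S x -> x <= a).
Proof.
split=> [Sa x Sx|]; last exact: fsup_least.
exact: le_trans (fsup_ub _ _ Sx) Sa.
Qed.

HB.factory Record isFrameOfSup (d : Order.disp_t) T of Choice T := {
  fle : T -> T -> Prop;
  fmeet : T -> T -> T;
  fjoin : set T -> T;
  fle_refl : forall x, fle x x;
  fle_anti : forall x y, fle x y -> fle y x -> x = y;
  fle_trans : forall y x z, fle x y -> fle y z -> fle x z;
  fle_meet : forall x y z, fle x (fmeet y z) <-> fle x y /\ fle x z;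
  fjoin_le : forall S a, fle (fjoin S) a <-> (forall x, S x -> fle x a);
  fmeet_join : forall a S,
    fle (fmeet a (fjoin S)) (fjoin [set fmeet a x | x in S]) }.

HB.builders Context (d : Order.disp_t) T of isFrameOfSup d T.

Let le (x y : T) : bool := `[< fle x y >].

Let le_refl : reflexive le.
Proof. by move=> x; apply/asboolP; apply: fle_refl. Qed.
Let le_anti : antisymmetric le.
Proof. by move=> x y /andP[/asboolP xy /asboolP yx]; apply: fle_anti. Qed.
Let le_trans : transitive le.
Proof.
by move=> y x z /asboolP xy /asboolP yz; apply/asboolP; apply: fle_trans yz.
Qed.

HB.instance Definition _ :=
  Order.Le_isPOrder.Build d T le_refl le_anti le_trans.

Let leE (x y : T) : (x <= y) = `[< fle x y >]. Proof. by []. Qed.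

Let meetP (x y z : T) : (x <= fmeet y z) = (x <= y) && (x <= z).
Proof.
rewrite !leE; apply/asboolP/andP; rewrite fle_meet.
  by case=> *; split; apply/asboolP.
by case=> /asboolP + /asboolP.
Qed.

Let join (x y : T) := fjoin [set x; y].

Let joinP (x y z : T) : (join x y <= z) = (x <= z) && (y <= z).
Proof.
rewrite !leE; apply/asboolP/andP; rewrite fjoin_le.
  by move=> xyz; split; apply/asboolP; apply: xyz; [left|right].
by case=> /asboolP xz /asboolP yz _ [->|->].
Qed.

HB.instance Definition _ :=
  Order.POrder_MeetJoin_isLattice.Build d T meetP joinP.

Let meetUl : @left_distributive T T Order.meet Order.join.
Proof.
move=> x y z; apply: Order.POrderTheory.le_anti; apply/andP; split; last first.
  by rewrite leUx !lexI !leIr !andbT !leIxl ?leUl ?leUr.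
rewrite meetC leE; apply/asboolP.
apply: (fle_trans (fmeet_join z [set x; y])).
apply/fjoin_le => _ [w [->|->] <-]; apply/asboolP; rewrite -leE.
- by change (z `&` x <= (x `&` z) `|` (y `&` z)); rewrite meetC leUl.
- by change (z `&` y <= (x `&` z) `|` (y `&` z)); rewrite (meetC z) leUr.
Qed.

HB.instance Definition _ := Order.Lattice_Meet_isDistrLattice.Build d T meetUl.

Let le0x (x : T) : fjoin set0 <= x.
Proof. by rewrite leE; apply/asboolP/fjoin_le. Qed.
Let lex1 (x : T) : x <= fjoin setT.
Proof.
by rewrite leE; apply/asboolP; apply: (fjoin_le setT _).1 => //; apply: fle_refl.
Qed.

HB.instance Definition _ := Order.hasBottom.Build d T le0x.
HB.instance Definition _ := Order.hasTop.Build d T lex1.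

Let sup_ub (S : set T) x : S x -> x <= fjoin S.
Proof.
by move=> Sx; rewrite leE; apply/asboolP; apply: (fjoin_le S _).1 => //;
  apply: fle_refl.
Qed.
Let sup_least (S : set T) a : (forall x, S x -> x <= a) -> fjoin S <= a.
Proof.
by move=> Sa; rewrite leE; apply/asboolP/fjoin_le => x /Sa; rewrite leE => /asboolP.
Qed.
Let meet_sup (a : T) (S : set T) : a `&` fjoin S = fjoin [set a `&` x | x in S].
Proof.
apply: Order.POrderTheory.le_anti; apply/andP; split.
  by rewrite leE; apply/asboolP; apply: fmeet_join.
by apply: sup_least => _ [x Sx <-]; rewrite lexI leIl leIxr ?sup_ub.
Qed.

HB.instance Definition _ := isFrame.Build d T sup_ub sup_least meet_sup.
HB.end.

(* Displays carry no mathematical content: they only control printing. *)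
Fact frame_display : Order.disp_t. Proof. exact. Qed.

Section Bool.
Let bool_sup (S : set bool) : bool := `[< S true >].
Let bool_ub (S : set bool) x : S x -> x <= bool_sup S.
Proof. by case: x => // St; rewrite /bool_sup asboolT. Qed.
Let bool_least (S : set bool) a : (forall x, S x -> x <= a) -> bool_sup S <= a.
Proof. by rewrite /bool_sup; case: asboolP => // St /(_ _ St). Qed.
Let bool_meet_sup (a : bool) (S : set bool) :
  a `&` bool_sup S = bool_sup [set a `&` x | x in S].
Proof.
case: a.
  by rewrite meet1x; congr bool_sup; rewrite -[LHS]image_id;
    apply: eq_imagel => x _; rewrite meet1x.
by rewrite meet0x; apply/esym/asboolPn => -[x _]; rewrite meet0x.
Qed.
HB.instance Definition _ :=
  isFrame.Build _ bool bool_ub bool_least bool_meet_sup.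
End Bool.

Record frame_hom d d' (L : frameType d) (M : frameType d') := FrameHom {
  fhom :> L -> M;
  fhom_top : fhom \top = \top;
  fhom_meet : forall a b, fhom (a `&` b) = fhom a `&` fhom b;
  fhom_sup : forall S : set L, fhom (fsup S) = fsup (fhom @` S) }.

Section FrameHomTheory.
Context {d d' d'' : Order.disp_t}.
Context {L : frameType d} {M : frameType d'} {N : frameType d''}.

Lemma frame_hom_eq (f g : frame_hom L M) : f =1 g -> f = g.
Proof.
case: f g => [f ? ? ?] [g ? ? ?] /= /funext fg; subst g.
by congr FrameHom; apply: Prop_irrelevance.
Qed.

Lemma fsup0 : fsup (set0 : set L) = \bot.
Proof. by apply/eqP; rewrite -lex0; apply/fsup_leP. Qed.

Lemma fsup2 (a b : L) : fsup [set a; b] = a `|` b.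
Proof.
apply: le_anti; apply/andP; split.
  by apply/fsup_leP => _ [->|->]; rewrite ?leUl ?leUr.
by rewrite leUx !fsup_ub //; [right|left].
Qed.

Lemma fhom_le (f : frame_hom L M) a b : a <= b -> f a <= f b.
Proof. by rewrite !leEmeet -fhom_meet => /eqP ->. Qed.

Definition frame_id : frame_hom L L :=
  @FrameHom _ _ L L id erefl (fun _ _ => erefl)
    (fun S => congr1 fsup (esym (image_id S))).

Definition frame_comp (g : frame_hom M N) (f : frame_hom L M) : frame_hom L N.
Proof.
refine (@FrameHom _ _ L N (fun x => g (f x)) _ _ _).
- by rewrite !fhom_top.
- by move=> a b; rewrite !fhom_meet.
- by move=> S; rewrite !fhom_sup image_comp.
Defined.
End FrameHomTheory.

Lemma fhom_bot d d' (L : frameType d) (M : frameType d') (f : frame_hom L M) :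
  f \bot = \bot.
Proof. by rewrite -!fsup0 fhom_sup image_set0. Qed.

Lemma fhom_join d d' (L : frameType d) (M : frameType d')
  (f : frame_hom L M) a b : f (a `|` b) = f a `|` f b.
Proof. by rewrite -!fsup2 fhom_sup image_setU !image_set1. Qed.

Definition Frm : category.
Proof.
refine (@Category (frameType frame_display) (fun L M => frame_hom L M)
  (fun L => frame_id) (fun _ _ _ g f => frame_comp g f) _ _ _);
  by move=> *; apply: frame_hom_eq.
Defined.

Definition Top : category.
Proof.
refine (@Category topologicalType (fun X Y => continuousType X Y)
  (fun X => idfun) (fun _ _ _ g f => g \o f) _ _ _);
  by move=> *; apply/continuousEP.
Defined.

Record opens (X : topologicalType) := Opens {
  oset :> set X;
  osetP : open oset }.

Lemma opens_eq (X : topologicalType) (A B : opens X) :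
  oset A = oset B -> A = B.
Proof.
by case: A B => [A ?] [B ?] /= AB; subst B;
  congr Opens; apply: Prop_irrelevance.
Qed.

HB.instance Definition _ (X : topologicalType) := gen_eqMixin (opens X).
HB.instance Definition _ (X : topologicalType) := gen_choiceMixin (opens X).

Section OpensFrame.
Variable X : topologicalType.

Definition opens_meet (A B : opens X) : opens X := Opens (openI (osetP A) (osetP B)).

Definition opens_sup (S : set (opens X)) : opens X :=
  @Opens X (\bigcup_(A in S) oset A) (bigcup_open (fun A _ => osetP A)).

Let opens_anti (A B : opens X) :
  (oset A `<=` oset B)%classic -> (oset B `<=` oset A)%classic -> A = B.
Proof. by move=> AB BA; apply: opens_eq; apply/seteqP. Qed.

Let opens_le_meet (A B D : opens X) :
  (oset A `<=` oset (opens_meet B D))%classic <->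
  (oset A `<=` oset B)%classic /\ (oset A `<=` oset D)%classic.
Proof.
split=> [ABD|[AB AD] x Ax]; first by split=> x /ABD[].
by split; [apply: AB|apply: AD].
Qed.

Let opens_sup_le (S : set (opens X)) (A : opens X) :
  (oset (opens_sup S) `<=` oset A)%classic <->
  (forall B, S B -> (oset B `<=` oset A)%classic).
Proof.
split=> [SA B SB x Bx|SA x [B SB Bx]]; first by apply: SA; exists B.
exact: SA SB _ Bx.
Qed.

Let opens_meet_sup (A : opens X) (S : set (opens X)) :
  (oset (opens_meet A (opens_sup S)) `<=`
   oset (opens_sup [set opens_meet A B | B in S]))%classic.
Proof.
by move=> x [Ax [B SB Bx]]; exists (opens_meet A B) => //; exists B.
Qed.

HB.instance Definition _ := @isFrameOfSup.Build frame_display (opens X)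
  (fun A B => (oset A `<=` oset B)%classic) opens_meet opens_sup
  (fun A => @subset_refl _ A) opens_anti (fun B A D => @subset_trans _ B A D)
  opens_le_meet opens_sup_le opens_meet_sup.

Lemma opens_leP (A B : opens X) :
  A <= B <-> (oset A `<=` oset B)%classic.
Proof. by split=> [/asboolP|AB]; last exact/asboolP. Qed.

Lemma oset_top : oset (\top : opens X) = setT.
Proof.
by apply/seteqP; split=> // x _; exists (Opens openT).
Qed.

Lemma oset_bot : oset (\bot : opens X) = set0.
Proof. by apply/seteqP; split=> // x []. Qed.

Lemma oset_meet (A B : opens X) : oset (A `&` B) = (oset A `&` oset B)%classic.
Proof. by []. Qed.

Lemma oset_join (A B : opens X) : oset (A `|` B) = (oset A `|` oset B)%classic.
Proof.
apply/seteqP; split=> x; first by case=> _ [->|->]; [left|right].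
by case=> ?; [exists A|exists B] => //; [left|right].
Qed.

Lemma oset_sup (S : set (opens X)) :
  oset (fsup S) = \bigcup_(A in S) oset A.
Proof. by []. Qed.
End OpensFrame.

Definition opens_preimage (X Y : topologicalType) (f : continuousType X Y)
    (V : opens Y) : opens X :=
  @Opens X (f @^-1` oset V)
    ((@continuousP X Y f).1 (@cts_fun _ _ f) _ (osetP V)).

Definition opens_map (X Y : topologicalType) (f : continuousType X Y) :
  frame_hom (opens Y) (opens X).
Proof.
refine (@FrameHom _ _ (opens Y) (opens X) (opens_preimage f) _ _ _).
- by apply: opens_eq; rewrite [RHS]oset_top -(preimage_setT f) -(oset_top Y).
- by move=> A B; apply: opens_eq.
- move=> S; apply: opens_eq; rewrite oset_sup bigcup_image /=.
  by rewrite preimage_bigcup.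
Defined.

Definition O_functor : functor Top (op_cat Frm).
Proof.
refine (@Functor Top (op_cat Frm) (fun X => opens X : Frm)
  (fun X Y f => opens_map f : @arr (op_cat Frm) (opens X) (opens Y)) _ _).
- by move=> X; apply: frame_hom_eq => A; apply: opens_eq.
- by move=> X Y Z g f; apply: frame_hom_eq => A; apply: opens_eq.
Defined.

Definition spectrum d (L : frameType d) : Type := frame_hom L bool.

HB.instance Definition _ d (L : frameType d) := gen_eqMixin (spectrum L).
HB.instance Definition _ d (L : frameType d) := gen_choiceMixin (spectrum L).

Section SpectrumTopology.
Context {d : Order.disp_t} (L : frameType d).

Definition spec_open (a : L) : set (spectrum L) :=
  [set f : spectrum L | (f : frame_hom L bool) a = true].

Definition spec_opens : set_system (spectrum L) := range spec_open.

Lemma spec_open_top : spec_open \top = setT.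
Proof. by apply/seteqP; split=> // f _; rewrite /spec_open /= fhom_top. Qed.

Lemma spec_open_meet a b :
  spec_open (a `&` b) = (spec_open a `&` spec_open b)%classic.
Proof.
apply/seteqP; split=> f; rewrite /spec_open /= fhom_meet.
  by move=> /andP.
by move=> [fa fb]; apply/andP.
Qed.

Lemma spec_open_sup (S : set L) :
  spec_open (fsup S) = \bigcup_(a in S) spec_open a.
Proof.
apply/seteqP; split=> f; rewrite /spec_open /= fhom_sup.
  by move=> /asboolP[a Sa fa]; exists a.
by move=> [a Sa fa]; apply/asboolP; exists a.
Qed.

Let spec_opensT : spec_opens setT.
Proof. by exists \top => //; apply: spec_open_top. Qed.

Let spec_opensI : setI_closed spec_opens.
Proof.
by move=> _ _ [a _ <-] [b _ <-]; exists (a `&` b) => //; apply: spec_open_meet.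
Qed.

Let spec_opens_bigU (I : Type) (f : I -> set (spectrum L)) :
  (forall i, spec_opens (f i)) -> spec_opens (\bigcup_i f i).
Proof.
move=> fo; exists (fsup [set a | exists i, f i = spec_open a]) => //.
rewrite spec_open_sup; apply/seteqP; split=> x.
  by move=> [a [i fi] ax]; exists i => //; rewrite fi.
move=> [i _ fix_]; have [a _ ai] := fo i.
by exists a; [exists i|rewrite ai].
Qed.

HB.instance Definition _ := isOpenTopological.Build (spectrum L)
  spec_opensT spec_opensI spec_opens_bigU.

Lemma open_spec (A : set (spectrum L)) : open A <-> spec_opens A.
Proof. by []. Qed.
End SpectrumTopology.

Section SpecMap.
Context {d d' : Order.disp_t} {L : frameType d} {M : frameType d'}.
Variable h : frame_hom L M.

Let spec_fun (f : spectrum M) : spectrum L := frame_comp f h.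

Let spec_cts : continuous spec_fun.
Proof. by apply/continuousP => _ [a _ <-]; exists (h a). Qed.

Definition spec_map : continuousType (spectrum M) (spectrum L) :=
  mkcts spec_cts.
End SpecMap.

Definition Sigma_functor : functor (op_cat Frm) Top.
Proof.
refine (@Functor (op_cat Frm) Top (fun L : Frm => spectrum L : Top)
  (fun L M h => spec_map h) _ _).
- by move=> L; apply/continuousEP => f; apply: frame_hom_eq.
- by move=> L M N g f; apply/continuousEP => x; apply: frame_hom_eq.
Defined.

Section OSigmaUnit.
Variable X : topologicalType.

Let point_hom (x : X) : spectrum (opens X).
Proof.
refine (@FrameHom _ _ (opens X) bool (fun A => `[< oset A x >]) _ _ _).
- by rewrite oset_top; apply/asboolP.
- by move=> A B; rewrite oset_meet asbool_and.
- move=> S; apply/asboolP/asboolP => [[A SA Ax]|[A SA /asboolP Ax]].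
    by exists A => //; apply/asboolP.
  by exists A.
Defined.

Let point_hom_cts : continuous point_hom.
Proof.
apply/continuousP => _ [A _ <-].
rewrite [X in open X](_ : _ = oset A); first exact: osetP.
by apply/seteqP; split=> x /=; rewrite /spec_open /= => /asboolP.
Qed.

Definition O_Sigma_unit : continuousType X (spectrum (opens X)) :=
  mkcts point_hom_cts.
End OSigmaUnit.

Section OSigmaCounit.
Context {d : Order.disp_t} (L : frameType d).

Let spec_opens_of (a : L) : opens (spectrum L) :=
  @Opens (spectrum L) (spec_open a) (imageT (@spec_open _ L) a).

Definition O_Sigma_counit : frame_hom L (opens (spectrum L)).
Proof.
refine (@FrameHom _ _ L (opens (spectrum L)) spec_opens_of _ _ _).
- by apply: opens_eq; rewrite oset_top; apply: spec_open_top.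
- by move=> a b; apply: opens_eq; apply: spec_open_meet.
- move=> S; apply: opens_eq; rewrite oset_sup bigcup_image.
  exact: spec_open_sup.
Defined.
End OSigmaCounit.

Definition O_Sigma_adjunction : adjunction O_functor Sigma_functor.
Proof.
pose eta := @NatTrans Top Top (id_functor Top) (Sigma_functor \of O_functor)
  (fun X => O_Sigma_unit X).
pose eps := @NatTrans (op_cat Frm) (op_cat Frm) (O_functor \of Sigma_functor)
  (id_functor (op_cat Frm)) (fun L : Frm => O_Sigma_counit L).
have eta_nat : forall (X Y : Top) (f : arr X Y),
    (O_Sigma_unit Y : @arr Top _ _) \oc f
    = fun_arr (Sigma_functor \of O_functor) f \oc O_Sigma_unit X.
  by move=> X Y f; apply/continuousEP => x; apply: frame_hom_eq.
have eps_nat : forall (L M : op_cat Frm) (f : arr L M),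
    (O_Sigma_counit M : @arr (op_cat Frm) _ _)
      \oc fun_arr (O_functor \of Sigma_functor) f
    = f \oc (O_Sigma_counit L : @arr (op_cat Frm) _ _).
  by move=> L M f; apply: frame_hom_eq => a; apply: opens_eq.
refine (@Adjunction _ _ _ _ (eta eta_nat) (eps eps_nat) _ _).
- move=> X; apply: frame_hom_eq => A; apply: opens_eq.
  by apply/seteqP; split=> x /=; rewrite /spec_open /= => /asboolP.
- move=> L; apply/continuousEP => f; apply: frame_hom_eq => a /=.
  by rewrite /spec_open /=; apply/asboolP/idP.
Defined.

Section WayBelow.
Context {d : Order.disp_t} {L : frameType d}.

Definition way_below (a b : L) : Prop :=
  forall S : set L, b <= fsup S ->
    exists G : set L, [/\ finite_set G, (G `<=` S)%classic & a <= fsup G].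

End WayBelow.

(* [way_below] is a bounded sublattice of the product of [L] with itself. *)
Definition way_below_sublattice d (L : frameType d) : Prop :=
  [/\ way_below (\bot : L) \bot, way_below (\top : L) \top,
      forall a b a' b' : L, way_below a b -> way_below a' b' ->
        way_below (a `&` a') (b `&` b') &
      forall a b a' b' : L, way_below a b -> way_below a' b' ->
        way_below (a `|` a') (b `|` b')].

Definition stably_compact_frame d (L : frameType d) : Prop :=
  way_below_sublattice L /\
  forall a : L, a = fsup [set x | way_below x a].

Definition proper_frame_hom d d' (L : frameType d) (M : frameType d')
    (h : frame_hom L M) : Prop :=
  forall a b, way_below a b -> way_below (h a) (h b).

Definition irreducible_closed (X : topologicalType) (A : set X) : Prop :=
  [/\ closed A, A !=set0 &
    forall B D : set X, closed B -> closed D -> (A `<=` B `|` D)%classic ->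
      (A `<=` B)%classic \/ (A `<=` D)%classic].

Definition sober (X : topologicalType) : Prop :=
  forall A : set X, irreducible_closed A -> exists! x, A = closure [set x].

(* The library's [locally_compact] only provides one closed compact
   neighbourhood of each point, which differs from the following condition in
   the absence of separation. *)
Definition has_compact_nbhs_bases (X : topologicalType) : Prop :=
  forall (x : X) (U : set X), nbhs x U ->
    exists K : set X, [/\ nbhs x K, (K `<=` U)%classic & compact K].

Definition stably_compact_space (X : topologicalType) : Prop :=
  [/\ compact [set: X], has_compact_nbhs_bases X, sober X
    & way_below_sublattice (opens X)].

Definition proper_map (X Y : topologicalType) (f : continuousType X Y) : Prop :=
  proper_frame_hom (opens_map f).

Definition StKFrm : subcategory Frm.
Proof.
refine (@Subcategory Frm (fun L => stably_compact_frame L)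
  (fun L M h => proper_frame_hom h) _ _); first by move=> L _ a b.
by move=> L M N g f _ _ _ gp fp a b ab; apply: gp; apply: fp.
Defined.

Definition StKSp : subcategory Top.
Proof.
refine (@Subcategory Top stably_compact_space
  (fun X Y f => proper_map f) _ _).
- move=> X _ A B; have idE (D : opens X) : opens_map idfun D = D.
    by apply: opens_eq.
  by rewrite !idE.
- move=> X Y Z g f _ _ _ gp fp A B AB.
  have compE (D : opens Z) :
      opens_map (g \o f) D = opens_map f (opens_map g D) by apply: opens_eq.
  by rewrite !compE; apply: fp; apply: gp.
Defined.

Definition KHaus : subcategory Top :=
  full_sub (C := Top) (fun X => compact [set: X] /\ hausdorff_space X).

Section Regular.
Context {d : Order.disp_t} {L : frameType d}.

Definition rather_below (a b : L) : Prop :=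
  exists c : L, a `&` c = \bot /\ c `|` b = \top.

(* Only the values of the scale [s] on the rationals of [0, 1] matter. *)
Definition completely_below (a b : L) : Prop :=
  exists s : rat -> L, [/\ s 0%R = a, s 1%R = b &
    forall p q : rat, (0 <= p)%R -> (p < q)%R -> (q <= 1)%R ->
      rather_below (s p) (s q)].

End Regular.

Definition regular_frame d (L : frameType d) : Prop :=
  forall a : L, a = fsup [set x | rather_below x a].

Definition completely_regular_frame d (L : frameType d) : Prop :=
  forall a : L, a = fsup [set x | completely_below x a].

Definition compact_frame d (L : frameType d) : Prop :=
  way_below (\top : L) \top.

Definition KRegFrm : subcategory Frm :=
  full_sub (C := Frm) (fun L => compact_frame L /\ regular_frame L).

Section Filters.
Context {d : Order.disp_t} {L : tbLatticeType d}.

Definition lattice_filter (p : set L) : Prop :=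
  [/\ p \top, forall a b, a <= b -> p a -> p b &
      forall a b, p a -> p b -> p (a `&` b)].

Definition proper_filter (p : set L) : Prop := lattice_filter p /\ ~ p \bot.

Definition ultrafilter (p : set L) : Prop :=
  proper_filter p /\
  forall q : set L, proper_filter q -> (p `<=` q)%classic -> q = p.

Definition is_prime_filter (p : set L) : Prop :=
  proper_filter p /\ forall a b, p (a `|` b) -> p a \/ p b.

End Filters.

Definition boolean_ultrafilter_theorem : Prop :=
  forall (d : Order.disp_t) (B : ctbDistrLatticeType d) (p : set B),
    proper_filter p -> exists u : set B, ultrafilter u /\ (p `<=` u)%classic.

Record open_prime_filter (X : topologicalType) := OpenPrimeFilter {
  opfset :> set (opens X);
  opfsetP : is_prime_filter opfset }.

Lemma open_prime_filter_eq (X : topologicalType) (p q : open_prime_filter X) :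
  (forall A, opfset p A <-> opfset q A) -> p = q.
Proof.
move=> pq; have {}pq : opfset p = opfset q by apply/seteqP; split=> A /pq.
by case: p q pq => [p ?] [q ?] /= pq; subst q;
  congr OpenPrimeFilter; apply: Prop_irrelevance.
Qed.

HB.instance Definition _ (X : topologicalType) :=
  gen_eqMixin (open_prime_filter X).
HB.instance Definition _ (X : topologicalType) :=
  gen_choiceMixin (open_prime_filter X).

Section OpenPrimeFilterTopology.
Variable X : topologicalType.

Definition opf_basic (A : opens X) : set (open_prime_filter X) :=
  [set p | opfset p A].

Definition opf_opens : set_system (open_prime_filter X) :=
  [set \bigcup_(A in S) opf_basic A | S in [set: set (opens X)]].

Lemma opf_basic_meet A B :
  opf_basic (A `&` B) = (opf_basic A `&` opf_basic B)%classic.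
Proof.
apply/seteqP; split=> p; case: (opfsetP p) => -[[_ up meet] _] _.
  by move=> pAB; split; apply: up pAB; rewrite ?leIl ?leIr.
by move=> [pA pB]; apply: meet.
Qed.

Lemma opf_basic_top : opf_basic \top = setT.
Proof. by apply/seteqP; split=> // p _; case: (opfsetP p) => -[[]]. Qed.

Let opf_opensT : opf_opens setT.
Proof.
exists [set \top] => //; rewrite bigcup_set1; exact: opf_basic_top.
Qed.

Let opf_opensI : setI_closed opf_opens.
Proof.
move=> _ _ [S _ <-] [S' _ <-].
exists [set D | exists A B, [/\ S A, S' B & D = A `&` B]] => //.
apply/seteqP; split=> p.
  move=> [_ [A [B [SA SB ->]]]]; rewrite opf_basic_meet => -[pA pB].
  by split; [exists A|exists B].
move=> [[A SA pA] [B SB pB]]; exists (A `&` B); first by exists A, B.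
by rewrite opf_basic_meet.
Qed.

Let opf_opens_bigU (I : Type) (f : I -> set (open_prime_filter X)) :
  (forall i, opf_opens (f i)) -> opf_opens (\bigcup_i f i).
Proof.
move=> fo; exists [set A | exists i, (opf_basic A `<=` f i)%classic] => //.
apply/seteqP; split=> p; first by move=> [A [i Ai] pA]; exists i => //; apply: Ai.
move=> [i _ fip]; have [S _ Si] := fo i; move: fip; rewrite -Si => -[A SA pA].
by exists A => //; exists i; rewrite -Si => q qA; exists A.
Qed.

HB.instance Definition _ := isOpenTopological.Build (open_prime_filter X)
  opf_opensT opf_opensI opf_opens_bigU.

Lemma open_opf (U : set (open_prime_filter X)) : open U <-> opf_opens U.
Proof. by []. Qed.

Lemma open_opf_basic A : open (opf_basic A).
Proof. by apply/open_opf; exists [set A] => //; rewrite bigcup_set1. Qed.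

Let nbhs_filter (x : X) : open_prime_filter X.
Proof.
refine (@OpenPrimeFilter X [set A | oset A x] _).
have setE A : [set A : opens X | oset A x] A = oset A x by [].
split; last by move=> A B; rewrite !setE oset_join.
split; last by rewrite setE oset_bot.
split; first by rewrite setE oset_top.
- by move=> A B /opens_leP; apply.
- by move=> A B; rewrite !setE oset_meet.
Defined.

Let nbhs_filter_cts : continuous nbhs_filter.
Proof.
apply/continuousP => _ [S _ <-]; rewrite preimage_bigcup.
by apply: bigcup_open => A _; apply: osetP.
Qed.

Definition opf_unit : continuousType X (open_prime_filter X) :=
  mkcts nbhs_filter_cts.
End OpenPrimeFilterTopology.

Section OpenPrimeFilterMap.
Variables (X Y : topologicalType) (f : continuousType X Y).

Let opf_fun (p : open_prime_filter X) : open_prime_filter Y.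
Proof.
refine (@OpenPrimeFilter Y [set B | opfset p (opens_map f B)] _).
have setE B : [set B | opfset p (opens_map f B)] B = opfset p (opens_map f B).
  by [].
case: (opfsetP p) => -[[top up meet] bot] prime.
split; last by move=> A B; rewrite !setE fhom_join; apply: prime.
split; last by rewrite setE fhom_bot.
split; first by rewrite setE fhom_top.
- by move=> A B AB; apply: up; apply: fhom_le.
- by move=> A B; rewrite !setE fhom_meet; apply: meet.
Defined.

Let opf_cts : continuous opf_fun.
Proof.
apply/continuousP => _ [S _ <-]; rewrite preimage_bigcup.
by apply: bigcup_open => A _; apply: (open_opf_basic (opens_map f A)).
Qed.

Definition opf_map :
    continuousType (open_prime_filter X) (open_prime_filter Y) :=
  mkcts opf_cts.
End OpenPrimeFilterMap.

Definition F_functor : functor Top Top.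
Proof.
refine (@Functor Top Top (fun X => open_prime_filter X : Top)
  (fun X Y f => opf_map f) _ _).
- move=> X; apply/continuousEP => p; apply: open_prime_filter_eq => A /=.
  by rewrite (_ : opens_preimage _ A = A) //; apply: opens_eq.
- move=> X Y Z g f; apply/continuousEP => p.
  apply: open_prime_filter_eq => A /=.
  by rewrite (_ : opens_preimage _ A = opens_preimage f (opens_preimage g A)) //;
    apply: opens_eq.
Defined.

Definition F_unit : nat_trans (id_functor Top) F_functor.
Proof.
refine (@NatTrans Top Top (id_functor Top) F_functor (fun X => opf_unit X) _).
by move=> X Y f; apply/continuousEP => x; apply: open_prime_filter_eq.
Defined.

Section HausdorffReflection.
Variable X : topologicalType.

(* [haus_quot_hausdorff] and [Hausdorff_reflection] show that the quotient by
   this relation is the reflection. *)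
Definition haus_eq (x y : X) : Prop :=
  forall (Y : topologicalType) (f : X -> Y),
    hausdorff_space Y -> continuous f -> f x = f y.

Let haus_rel (x y : X) : bool := `[< haus_eq x y >].

Let haus_refl : reflexive haus_rel.
Proof. by move=> x; apply/asboolP. Qed.
Let haus_sym : symmetric haus_rel.
Proof.
by move=> x y; apply/asboolP/asboolP => xy Y f hY fc; rewrite (xy Y f).
Qed.
Let haus_trans : transitive haus_rel.
Proof.
move=> y x z /asboolP xy /asboolP yz; apply/asboolP => Y f hY fc.
by rewrite (xy Y f) ?(yz Y f).
Qed.

Definition haus_equiv : equiv_rel X := EquivRel _ haus_refl haus_sym haus_trans.

Definition haus_quot : topologicalType :=
  quotient_topology {eq_quot haus_equiv}%qT.

Definition haus_pi (x : X) : haus_quot := (\pi_({eq_quot haus_equiv}) x)%qT.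

Lemma haus_piP x y : haus_pi x = haus_pi y <-> haus_eq x y.
Proof.
by split=> [/(@eqmodP _ haus_equiv)/asboolP //|xy];
  apply/(@eqmodP _ haus_equiv)/asboolP.
Qed.

Lemma haus_pi_surj (z : haus_quot) : exists x, z = haus_pi x.
Proof. by exists (repr z); rewrite /haus_pi reprK. Qed.

Lemma haus_pi_continuous : continuous haus_pi.
Proof. exact: pi_continuous. Qed.

Section Extension.
Variables (Y : topologicalType) (hY : hausdorff_space Y).
Variable f : continuousType X Y.

Definition haus_lift (z : haus_quot) : Y := f (repr z).

Lemma haus_liftE x : haus_lift (haus_pi x) = f x.
Proof.
have : haus_pi (repr (haus_pi x)) = haus_pi x by rewrite /haus_pi reprK.
by move=> /haus_piP; apply=> //; apply: cts_fun.
Qed.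

Lemma haus_lift_continuous : continuous haus_lift.
Proof.
apply/quotient_continuous.
rewrite (_ : _ \o _ = f); first exact: cts_fun.
by apply: funext => x; apply: haus_liftE.
Qed.
End Extension.

Lemma haus_quot_hausdorff : hausdorff_space haus_quot.
Proof.
rewrite open_hausdorff => z w zw.
have [x zx] := haus_pi_surj z; have [y wy] := haus_pi_surj w; subst z w.
have : ~ haus_eq x y by move/haus_piP => xy; rewrite xy eqxx in zw.
move=> /existsNP[Y /existsNP[f /not_implyP[hY /not_implyP[fc /eqP fxy]]]].
pose g : continuousType X Y := mkcts fc.
have gc := @haus_lift_continuous Y hY g.
move: (hY); rewrite open_hausdorff => /(_ _ _ fxy)[[A B] /= [Ax By] [oA oB AB]].
exists (haus_lift g @^-1` A, haus_lift g @^-1` B) => /=.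
  have gE u : haus_lift g (haus_pi u) = f u by exact: haus_liftE.
  split; apply/mem_set.
    by suff : A (haus_lift g (haus_pi x)) by []; rewrite gE; apply/set_mem.
  by suff : B (haus_lift g (haus_pi y)) by []; rewrite gE; apply/set_mem.
split; [by apply: (continuousP _).1|by apply: (continuousP _).1|].
by rewrite -preimage_setI (eqP AB) preimage_set0.
Qed.
End HausdorffReflection.

Definition Hausdorff_reflection :
  reflection (C := Top) (fun X => hausdorff_space X).
Proof.
refine (@Reflection Top (fun X => hausdorff_space X) (fun X => haus_quot X)
  (fun X => haus_quot_hausdorff (X := X))
  (fun X => mkcts (@haus_pi_continuous X))
  (fun X Y hY f => mkcts (@haus_lift_continuous X Y hY f)) _ _).
- by move=> X Y hY f; apply/continuousEP => x; apply: haus_liftE.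
- move=> X Y hY f g gf; apply/continuousEP => z.
  have [x ->] := haus_pi_surj z; rewrite [RHS]haus_liftE // -gf //.
Defined.

Definition R_functor : functor Top Top := reflector Hausdorff_reflection.

Definition R_unit : nat_trans (id_functor Top) R_functor :=
  reflector_unit Hausdorff_reflection.

Section Ideals.
Context {d : Order.disp_t}.

Definition is_ideal (L : tbLatticeType d) (J : set L) : Prop :=
  [/\ J \bot, forall a b, a <= b -> J b -> J a &
      forall a b, J a -> J b -> J (a `|` b)].

Record ideals (L : tbLatticeType d) := Ideal {
  iset :> set L;
  isetP : is_ideal iset }.

Lemma ideals_eq (L : tbLatticeType d) (J K : ideals L) :
  iset J = iset K -> J = K.
Proof.
by case: J K => [J ?] [K ?] /= JK; subst K; congr Ideal; apply: Prop_irrelevance.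
Qed.
End Ideals.

HB.instance Definition _ d (L : tbLatticeType d) := gen_eqMixin (ideals L).
HB.instance Definition _ d (L : tbLatticeType d) := gen_choiceMixin (ideals L).

Section IdealFrame.
Context {d : Order.disp_t} (L : frameType d).

Let meet_ideal (J K : ideals L) : is_ideal (iset J `&` iset K)%classic.
Proof.
case: (isetP J) (isetP K) => [J0 Jd Jj] [K0 Kd Kj].
split=> // [a b ab [Jb Kb]|a b [Ja Ka] [Jb Kb]].
  by split; [apply: Jd Jb|apply: Kd Kb].
by split; [apply: Jj|apply: Kj].
Qed.

Definition ideals_meet (J K : ideals L) : ideals L := Ideal (meet_ideal J K).

Let smallest_ideal (G : set L) : is_ideal (smallest (@is_ideal d L) G).
Proof.
split=> [J [[J0 _ _] _] //|a b ab Gb J JG|a b Ga Gb J JG].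
  by have [[_ Jd _] _] := JG; apply: Jd ab _; apply: Gb.
by have [[_ _ Jj] _] := JG; apply: Jj; [apply: Ga|apply: Gb].
Qed.

Definition ideals_sup (S : set (ideals L)) : ideals L :=
  Ideal (smallest_ideal (\bigcup_(J in S) iset J)).

Let ideals_anti (J K : ideals L) :
  (iset J `<=` iset K)%classic -> (iset K `<=` iset J)%classic -> J = K.
Proof. by move=> JK KJ; apply: ideals_eq; apply/seteqP. Qed.

Let ideals_le_meet (J K H : ideals L) :
  (iset J `<=` iset (ideals_meet K H))%classic <->
  (iset J `<=` iset K)%classic /\ (iset J `<=` iset H)%classic.
Proof.
split=> [JKH|[JK JH] x Jx]; first by split=> x /JKH[].
by split; [apply: JK|apply: JH].
Qed.

Lemma ideals_sup_le (S : set (ideals L)) (J : ideals L) :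
  (iset (ideals_sup S) `<=` iset J)%classic <->
  (forall K, S K -> (iset K `<=` iset J)%classic).
Proof.
split=> [SJ K SK x Kx|SJ x Sx].
  by apply: SJ => H [_ SH]; apply: SH; exists K.
apply: Sx; split; first exact: isetP.
by move=> y [K SK Ky]; apply: SJ Ky.
Qed.

Lemma ideals_sup_sub (S : set (ideals L)) K a :
  S K -> iset K a -> iset (ideals_sup S) a.
Proof. by move=> SK Ka H [_]; apply; exists K. Qed.

Let ideals_meet_sup (J : ideals L) (S : set (ideals L)) :
  (iset (ideals_meet J (ideals_sup S)) `<=`
   iset (ideals_sup [set ideals_meet J K | K in S]))%classic.
Proof.
move=> x [Jx Sx]; pose H := iset (ideals_sup [set ideals_meet J K | K in S]).
have [H0 Hd Hj] : is_ideal H := isetP _.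
have Hx : is_ideal [set y : L | H (x `&` y)].
  split=> /= [|a b ab|a b]; first by rewrite meetx0.
    by apply: Hd; apply: leI2.
  by rewrite meetUr; apply: Hj.
rewrite -[x]meetxx; apply: (Sx [set y | H (x `&` y)]); split=> // y [K SK Ky].
apply: (ideals_sup_sub (K := ideals_meet J K)); first by exists K.
have [_ Jd _] := isetP J; have [_ Kd _] := isetP K.
by split; [apply: Jd Jx; rewrite leIl|apply: Kd Ky; rewrite leIr].
Qed.

HB.instance Definition _ := @isFrameOfSup.Build frame_display (ideals L)
  (fun J K => (iset J `<=` iset K)%classic) ideals_meet ideals_sup
  (fun J => @subset_refl _ J) ideals_anti (fun J K H => @subset_trans _ J K H)
  ideals_le_meet ideals_sup_le ideals_meet_sup.

Lemma ideals_leP (J K : ideals L) : J <= K <-> (iset J `<=` iset K)%classic.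
Proof. by split=> [/asboolP|JK]; last exact/asboolP. Qed.

Lemma ideals_meetE (J K : ideals L) : J `&` K = ideals_meet J K.
Proof. by []. Qed.

Lemma ideals_supE (S : set (ideals L)) : fsup S = ideals_sup S.
Proof. by []. Qed.

Let setT_ideal : is_ideal [set: L]. Proof. by []. Qed.

Lemma iset_top : iset (\top : ideals L) = setT.
Proof.
apply/seteqP; split=> // x _.
by have /ideals_leP := lex1 (Ideal setT_ideal); apply.
Qed.

Lemma ideal_topP (J : ideals L) : J = \top <-> iset J \top.
Proof.
split=> [->|J1]; first by rewrite iset_top.
apply: ideals_eq; rewrite iset_top; apply/seteqP; split=> // x _.
by have [_ Jd _] := isetP J; apply: Jd J1; apply: lex1.
Qed.

Definition ideal_counit : frame_hom (ideals L) L.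
Proof.
refine (@FrameHom _ _ (ideals L) L (fun J => fsup (iset J)) _ _ _).
- by apply: le_anti; rewrite lex1 fsup_ub // iset_top.
- move=> J K; apply: le_anti; apply/andP; split.
    by rewrite lexI; apply/andP; split; apply/fsup_leP => x [Jx Kx];
      apply: fsup_ub.
  rewrite meet_fsup; apply/fsup_leP => _ [y Ky <-].
  rewrite meetC meet_fsup; apply/fsup_leP => _ [x Jx <-]; apply: fsup_ub.
  have [_ Jd _] := isetP J; have [_ Kd _] := isetP K.
  by split; [apply: Jd Jx; rewrite leIr|apply: Kd Ky; rewrite leIl].
- move=> S; apply: le_anti; apply/andP; split; last first.
    apply/fsup_leP => _ [J SJ <-]; apply/fsup_leP => x Jx.
    by apply: fsup_ub; apply: ideals_sup_sub SJ Jx.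
  apply/fsup_leP => x Sx.
  apply: (Sx [set y | y <= fsup [set fsup (iset J) | J in S]]); split.
    split=> /= [|a b ab bS|a b aS bS]; first exact: le0x.
      exact: le_trans bS.
    by rewrite leUx aS bS.
  move=> y [J SJ Jy] /=; apply: (le_trans (fsup_ub _ _ Jy)).
  by apply: fsup_ub; exists J.
Defined.
End IdealFrame.

Section IdealMap.
Context {d d' : Order.disp_t} {L : frameType d} {M : frameType d'}.
Variable h : frame_hom L M.

Let image_ideal (J : ideals L) :
  is_ideal [set y : M | exists2 x, iset J x & y <= h x].
Proof.
have [J0 Jd Jj] := isetP J.
split=> [|a b ab [x Jx bx]|a b [x Jx ax] [y Jy by_]].
- by exists \bot => //; apply: le0x.
- by exists x => //; apply: le_trans bx.
- exists (x `|` y); first exact: Jj.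
  by rewrite fhom_join leU2.
Qed.

Definition ideal_map : frame_hom (ideals L) (ideals M).
Proof.
refine (@FrameHom _ _ (ideals L) (ideals M)
  (fun J => Ideal (image_ideal J)) _ _ _).
- apply/ideal_topP; exists \top; last by rewrite fhom_top.
  by rewrite iset_top.
- move=> J K; apply: ideals_eq; apply/seteqP; split=> y.
    by move=> [x [Jx Kx] yx]; split; exists x.
  move=> [[x Jx yx] [z Kz yz]]; exists (x `&` z).
    have [_ Jd _] := isetP J; have [_ Kd _] := isetP K.
    by split; [apply: Jd Jx; rewrite leIl|apply: Kd Kz; rewrite leIr].
  by rewrite fhom_meet lexI yx yz.
- move=> S; apply: le_anti; apply/andP; split; last first.
    apply/fsup_leP => _ [J SJ <-]; apply/ideals_leP => y [x Jx yx].
    by exists x => //; apply: ideals_sup_sub SJ Jx.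
  apply/ideals_leP => y [x Sx yx].
  set H := fsup _; have [H0 Hd Hj] := isetP H; apply: (Hd _ _ yx).
  apply: (Sx [set z | iset H (h z)]); split.
    split=> /= [|a b ab|a b]; first by rewrite fhom_bot.
      by apply: Hd; apply: fhom_le.
    by rewrite fhom_join; apply: Hj.
  move=> z [J SJ Jz] /=.
  apply: (ideals_sup_sub (K := Ideal (image_ideal J))); first by exists J.
  by exists z.
Defined.
End IdealMap.

Definition I_functor : functor Frm Frm.
Proof.
refine (@Functor Frm Frm (fun L : Frm => ideals L : Frm)
  (fun L M h => ideal_map h) _ _).
- move=> L; apply: frame_hom_eq => J; apply: ideals_eq.
  have [_ Jd _] := isetP J.
  by apply/seteqP; split=> x; [case=> y Jy /Jd; apply|exists x].
- move=> L M N g f; apply: frame_hom_eq => J; apply: ideals_eq.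
  apply/seteqP; split=> z; first by move=> [x Jx zx]; exists (f x) => //; exists x.
  by move=> [y [x Jx yx] zy]; exists x => //; apply: le_trans zy (fhom_le _ yx).
Defined.

Definition I_counit : nat_trans I_functor (id_functor Frm).
Proof.
refine (@NatTrans Frm Frm I_functor (id_functor Frm)
  (fun L : Frm => ideal_counit L) _).
move=> L M f; apply: frame_hom_eq => J /=; apply: le_anti; apply/andP; split.
  apply/fsup_leP => y [x Jx yx]; apply: (le_trans yx).
  by apply: fhom_le; apply: fsup_ub.
rewrite fhom_sup; apply/fsup_leP => _ [x Jx <-].
by apply: fsup_ub; exists x.
Defined.

Section RatherBelow.
Context {d : Order.disp_t} {L : frameType d}.
Implicit Types a b x y : L.

Lemma rather_below_le a b : rather_below a b -> a <= b.
Proof.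
by move=> [c [ac cb]]; rewrite -[a]meetx1 -cb meetUr ac join0x leIr.
Qed.

Lemma rather_below_mono a a' b b' :
  a' <= a -> b <= b' -> rather_below a b -> rather_below a' b'.
Proof.
move=> aa bb [c [ac cb]]; exists c; split.
  by apply/eqP; rewrite -lex0 -ac leI2.
by apply/eqP; rewrite -le1x -cb leU2.
Qed.

Lemma rather_below_meet a b a' b' : rather_below a b -> rather_below a' b' ->
  rather_below (a `&` a') (b `&` b').
Proof.
move=> [c [ac cb]] [c' [ac' cb']]; exists (c `|` c'); split.
  by rewrite meetUr meetAC ac meet0x join0x -meetA ac' meetx0.
by rewrite joinIr joinAC cb join1x -joinA cb' joinx1 meetxx.
Qed.

Lemma completely_below_le a b : completely_below a b -> a <= b.
Proof.
by move=> [s [<- <- sP]]; apply: rather_below_le; apply: sP.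
Qed.

Lemma completely_below_mono a a' b b' :
  a' <= a -> b <= b' -> completely_below a b -> completely_below a' b'.
Proof.
move=> aa bb [s [s0 s1 sP]].
pose t (q : rat) := if (q <= 0)%R then a' else if (1 <= q)%R then b' else s q.
exists t; split; rewrite /t // => p q p0 pq q1.
apply: rather_below_mono (sP p q p0 pq q1).
  case: ifPn => [p0'|_].
    by rewrite (_ : p = 0%R) ?s0 //; apply/eqP; rewrite eq_le p0 p0'.
  by rewrite ifN // -ltNge (lt_le_trans pq).
rewrite ifN -?ltNge ?(le_lt_trans p0) //; case: ifPn => // q1'.
by rewrite (_ : q = 1%R) ?s1 //; apply/eqP; rewrite eq_le q1 q1'.
Qed.

Lemma completely_below_meet a b a' b' :
  completely_below a b -> completely_below a' b' ->
  completely_below (a `&` a') (b `&` b').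
Proof.
move=> [s [s0 s1 sP]] [t [t0 t1 tP]].
exists (fun q => s q `&` t q); split; rewrite ?s0 ?s1 ?t0 ?t1 // => p q *.
by apply: rather_below_meet; [apply: sP|apply: tP].
Qed.

Lemma completely_below_top : completely_below (\top : L) \top.
Proof.
exists (fun=> \top); split=> // *; exists \bot; split; first exact: meetx0.
exact: joinx1.
Qed.

Definition pseudo_compl a : L := fsup [set c | a `&` c = \bot].

Lemma meet_pseudo_compl a : a `&` pseudo_compl a = \bot.
Proof.
apply/eqP; rewrite -lex0 meet_fsup; apply/fsup_leP => _ [c ac <-].
by rewrite ac.
Qed.

Lemma rather_below_compl a b : rather_below a b -> pseudo_compl a `|` b = \top.
Proof.
move=> [c [ac cb]]; apply/eqP; rewrite -le1x -cb leU2 //.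
exact: fsup_ub.
Qed.

Lemma compl_rather_below a b :
  rather_below a b -> rather_below (pseudo_compl b) (pseudo_compl a).
Proof.
move=> ab; exists b; split; first by rewrite meetC meet_pseudo_compl.
by rewrite joinC rather_below_compl.
Qed.

Definition cregular a : Prop := a = fsup [set x | completely_below x a].

Lemma cregularP a : a <= fsup [set x | completely_below x a] -> cregular a.
Proof.
move=> aS; apply: le_anti; rewrite aS; apply/fsup_leP => x.
exact: completely_below_le.
Qed.

Lemma cregular_meet a b : cregular a -> cregular b -> cregular (a `&` b).
Proof.
move=> ra rb; apply: cregularP; rewrite {1}ra meetC meet_fsup.
apply/fsup_leP => _ [x xa <-]; rewrite {1}rb meetC meet_fsup.
apply/fsup_leP => _ [y yb <-]; apply: fsup_ub.
exact: completely_below_meet.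
Qed.

Lemma cregular_top : cregular \top.
Proof. by apply: cregularP; apply: fsup_ub; apply: completely_below_top. Qed.

Lemma cregular_sup (S : set L) :
  (forall a, S a -> cregular a) -> cregular (fsup S).
Proof.
move=> Sr; apply: cregularP; apply/fsup_leP => a Sa; rewrite {1}(Sr _ Sa).
apply/fsup_leP => x xa; apply: fsup_ub.
by apply: completely_below_mono xa => //; apply: fsup_ub.
Qed.

End RatherBelow.

Lemma fhom_rather_below d d' (L : frameType d) (M : frameType d')
  (h : frame_hom L M) a b : rather_below a b -> rather_below (h a) (h b).
Proof.
move=> [c [ac cb]]; exists (h c).
by rewrite -fhom_meet -fhom_join ac cb fhom_bot fhom_top.
Qed.

Lemma fhom_completely_below d d' (L : frameType d) (M : frameType d')
  (h : frame_hom L M) a b :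
  completely_below a b -> completely_below (h a) (h b).
Proof.
move=> [s [<- <- sP]]; exists (h \o s); split=> // p q *.
by apply: fhom_rather_below; apply: sP.
Qed.

Lemma fhom_cregular d d' (L : frameType d) (M : frameType d')
  (h : frame_hom L M) a : cregular a -> cregular (h a).
Proof.
move=> ra; apply: cregularP; rewrite {1}ra fhom_sup.
apply/fsup_leP => _ [x xa <-]; apply: fsup_ub.
exact: fhom_completely_below.
Qed.

(* The subframe of those elements that are joins of elements completely below
   them; [creg_coreflection] shows that it is the coreflection. *)
Record creg d (L : frameType d) := Creg {
  creg_val :> L;
  creg_valP : cregular creg_val }.

Lemma creg_eq d (L : frameType d) (a b : creg L) :
  creg_val a = creg_val b -> a = b.
Proof.
by case: a b => [a ?] [b ?] /= ab; subst b; congr Creg; apply: Prop_irrelevance.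
Qed.

HB.instance Definition _ d (L : frameType d) := gen_eqMixin (creg L).
HB.instance Definition _ d (L : frameType d) := gen_choiceMixin (creg L).

Section CregFrame.
Context {d : Order.disp_t} (L : frameType d).

Definition creg_meet (a b : creg L) : creg L :=
  Creg (cregular_meet (creg_valP a) (creg_valP b)).

Let creg_image (S : set (creg L)) (a : L) :
  (@creg_val d L @` S) a -> cregular a.
Proof. by move=> [b _ <-]; apply: creg_valP. Qed.

Definition creg_sup (S : set (creg L)) : creg L :=
  Creg (cregular_sup (@creg_image S)).

Let creg_anti (a b : creg L) :
  creg_val a <= creg_val b -> creg_val b <= creg_val a -> a = b.
Proof. by move=> ab ba; apply: creg_eq; apply: le_anti; rewrite ab ba. Qed.

Let creg_le_trans (b a c : creg L) : creg_val a <= creg_val b ->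
  creg_val b <= creg_val c -> creg_val a <= creg_val c.
Proof. exact: le_trans. Qed.

Let creg_le_meet (a b c : creg L) : creg_val a <= creg_val (creg_meet b c) <->
  creg_val a <= creg_val b /\ creg_val a <= creg_val c.
Proof. by rewrite /= lexI; split=> [/andP|[-> ->]]. Qed.

Let creg_sup_le (S : set (creg L)) (a : creg L) :
  creg_val (creg_sup S) <= creg_val a <->
  (forall x, S x -> creg_val x <= creg_val a).
Proof.
split=> [/fsup_leP Sa x Sx|Sa]; first by apply: Sa; exists x.
by apply/fsup_leP => _ [x Sx <-]; apply: Sa.
Qed.

Let creg_meet_sup (a : creg L) (S : set (creg L)) :
  creg_val (creg_meet a (creg_sup S))
  <= creg_val (creg_sup [set creg_meet a x | x in S]).
Proof.
rewrite /= meet_fsup; apply/fsup_leP => _ [_ [x Sx <-] <-].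
by apply: fsup_ub; exists (creg_meet a x) => //; exists x.
Qed.

HB.instance Definition _ := @isFrameOfSup.Build frame_display (creg L)
  (fun a b => creg_val a <= creg_val b) creg_meet creg_sup
  (fun a => lexx (creg_val a)) creg_anti creg_le_trans
  creg_le_meet creg_sup_le creg_meet_sup.

Lemma creg_leE (a b : creg L) : (a <= b) = (creg_val a <= creg_val b).
Proof. exact: asboolb. Qed.

Lemma creg_val_meet (a b : creg L) :
  creg_val (a `&` b) = creg_val a `&` creg_val b.
Proof. by []. Qed.

Lemma creg_val_sup (S : set (creg L)) :
  creg_val (fsup S) = fsup (@creg_val d L @` S).
Proof. by []. Qed.

Lemma creg_val_top : creg_val (\top : creg L) = \top.
Proof.
apply: le_anti; rewrite lex1 /=.
have := lex1 (Creg (@cregular_top d L)); by rewrite creg_leE.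
Qed.

Definition creg_incl : frame_hom (creg L) L :=
  @FrameHom _ _ (creg L) L (@creg_val d L) creg_val_top creg_val_meet
    creg_val_sup.

Section Lift.
Context {d' : Order.disp_t} {M : frameType d'}.
Hypothesis Mreg : completely_regular_frame M.
Variable h : frame_hom M L.

Definition creg_lift : frame_hom M (creg L).
Proof.
refine (@FrameHom _ _ M (creg L)
  (fun a => Creg (fhom_cregular h (Mreg a))) _ _ _).
- by apply: creg_eq; rewrite creg_val_top; apply: fhom_top.
- by move=> a b; apply: creg_eq; apply: fhom_meet.
- move=> S; apply: creg_eq; rewrite creg_val_sup image_comp.
  exact: fhom_sup.
Defined.
End Lift.

Section Scale.
Variable s : rat -> L.
Hypothesis sP : forall p q : rat, (0 <= p)%R -> (p < q)%R -> (q <= 1)%R ->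
  rather_below (s p) (s q).

Let s_le (p q : rat) : (0 <= p)%R -> (p <= q)%R -> (q <= 1)%R -> s p <= s q.
Proof.
move=> p0; rewrite le_eqVlt => /orP[/eqP-> //|pq q1].
exact: rather_below_le (sP p0 pq q1).
Qed.

Let scale_cb (p q : rat) : (0 <= p)%R -> (p < q)%R -> (q <= 1)%R ->
  completely_below (s p) (s q).
Proof.
move=> p0 pq q1; exists (fun r => s (p + r * (q - p))%R).
split; [by rewrite mul0r addr0|by rewrite mul1r addrC subrK|].
by move=> r r' r0 rr' r'1; apply: sP; nra.
Qed.

Let compl_cb (p q : rat) : (0 <= p)%R -> (p < q)%R -> (q <= 1)%R ->
  completely_below (pseudo_compl (s q)) (pseudo_compl (s p)).
Proof.
move=> p0 pq q1; exists (fun r => pseudo_compl (s (q + r * (p - q))%R)).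
split; [by rewrite mul0r addr0|by rewrite mul1r addrC subrK|].
by move=> r r' r0 rr' r'1; apply: compl_rather_below; apply: sP; nra.
Qed.

Let t (q : rat) : L := fsup [set x | exists2 r : rat, (0 <= r < q)%R & x = s r].

Let t_reg (q : rat) : (q <= 1)%R -> cregular (t q).
Proof.
move=> q1; apply: cregularP; apply/fsup_leP => _ [r /andP[r0 rq] ->].
apply: fsup_ub.
have rq2 : completely_below (s r) (s ((r + q) / 2)%R) by apply: scale_cb; lra.
apply: completely_below_mono rq2 => //.
by apply: fsup_ub; exists ((r + q) / 2)%R => //; lra.
Qed.

Let T (q : rat) : creg L :=
  match pselect (q <= 1)%R with
  | left q1 => Creg (t_reg q1)
  | right _ => \top
  end.

Let T_val (q : rat) : (q <= 1)%R -> creg_val (T q) = t q.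
Proof. by rewrite /T; case: pselect. Qed.

Let T_rb (p q : rat) : (0 <= p)%R -> (p < q)%R -> (q <= 1)%R ->
  rather_below (T p) (T q).
Proof.
move=> p0 pq q1; pose r1 := ((2 * p + q) / 3)%R; pose r2 := ((p + 2 * q) / 3)%R.
have [pr1 r12 r2q] : [/\ (p < r1)%R, (r1 < r2)%R & (r2 < q)%R].
  by split; rewrite /r1 /r2; lra.
clearbody r1 r2.
pose c := fsup [set x | exists2 r : rat, (r1 < r < r2)%R & x = pseudo_compl (s r)].
have c_reg : cregular c.
  apply: cregularP; apply/fsup_leP => _ [r /andP[r1r rr2] ->]; apply: fsup_ub.
  have rr1 : completely_below (pseudo_compl (s r))
      (pseudo_compl (s ((r1 + r) / 2)%R)) by apply: compl_cb; lra.
  apply: completely_below_mono rr1 => //.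
  by apply: fsup_ub; exists ((r1 + r) / 2)%R => //; lra.
exists (Creg c_reg); split.
  apply/eqP; rewrite -lex0 creg_leE creg_val_meet T_val /=; last lra.
  apply: (le_trans _ (le0x _)).
  rewrite meet_fsup; apply/fsup_leP => _ [_ [r /andP[r1r rr2] ->] <-].
  rewrite -(meet_pseudo_compl (s r)) leI2 //.
  apply/fsup_leP => _ [r' /andP[r'0 r'p] ->]; apply: s_le; lra.
apply/eqP; rewrite -le1x creg_leE creg_val_top.
have rb : rather_below (s ((r1 + r2) / 2)%R) (s r2) by apply: sP; lra.
rewrite -(rather_below_compl rb).
have cT : Creg c_reg <= Creg c_reg `|` T q by apply: leUl.
have TT : T q <= Creg c_reg `|` T q by apply: leUr.
rewrite !creg_leE T_val // in cT TT.
rewrite leUx (le_trans _ cT) ?(le_trans _ TT) //; apply: fsup_ub.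
  by exists r2 => //; lra.
by exists ((r1 + r2) / 2)%R => //; lra.
Qed.

Lemma creg_interpolate (a : creg L) : s 1%R = creg_val a ->
  exists2 y : creg L, completely_below y a & s 0%R <= creg_val y.
Proof.
move=> s1; exists (T (1 / 2)%R); last first.
  by rewrite T_val; [apply: fsup_ub; exists 0%R|lra].
exists (fun k => if (1 <= k)%R then a else T (1 / 2 + k / 2)%R).
split; [by rewrite /= mul0r addr0|by rewrite lexx|].
move=> p q p0 pq q1; rewrite ifN; last by rewrite -ltNge; lra.
case: ifPn => [q1'|_]; last by apply: T_rb; lra.
have T1 : rather_below (T (1 / 2 + p / 2)%R) (T 1%R) by apply: T_rb; lra.
apply: rather_below_mono T1 => //.
rewrite creg_leE T_val // -s1.
by apply/fsup_leP => _ [r /andP[r0 r1] ->]; apply: s_le; lra.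
Qed.
End Scale.

Lemma creg_completely_regular : completely_regular_frame (creg L).
Proof.
move=> a; apply: cregularP; rewrite creg_leE {1}(creg_valP a).
apply/fsup_leP => x [s [<- s1 sP]].
have [y ya sy] := creg_interpolate sP s1; apply: (le_trans sy).
by rewrite -creg_leE; apply: fsup_ub.
Qed.
End CregFrame.

Definition creg_coreflection :
  coreflection (C := Frm) (fun L => completely_regular_frame L).
Proof.
refine (@Coreflection Frm (fun L => completely_regular_frame L)
  (fun L : Frm => creg L : Frm) (fun L : Frm => @creg_completely_regular _ L)
  (fun L : Frm => creg_incl L) (fun M L Mreg h => creg_lift Mreg h) _ _).
- by move=> M L Mreg h; apply: frame_hom_eq.
- by move=> M L Mreg h g gh; apply: frame_hom_eq => a; apply: creg_eq; rewrite -gh.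
Defined.

Definition CReg_functor : functor Frm Frm := coreflector creg_coreflection.

Definition CReg_counit : nat_trans CReg_functor (id_functor Frm) :=
  coreflector_counit creg_coreflection.

Definition RF_functor : functor Top Top := R_functor \of F_functor.

Definition RF_unit : nat_trans (id_functor Top) RF_functor :=
  comp_unit R_unit F_unit.

Definition CRegI_functor : functor Frm Frm := CReg_functor \of I_functor.

Definition CRegI_counit : nat_trans CRegI_functor (id_functor Frm) :=
  comp_counit CReg_counit I_counit.

(* Main.v *)
(* On a stably compact frame, a prime filter [p] yields the point
   [c |-> exists y << c, y \in p]. Applied to prime filters separating elements
   this gives spatiality; applied to the traces of ultrafilters it gives
   compactness of the spectrum; applied to open prime filters of a compact
   Hausdorff space it is the limit map, by which a map [X -> Y] into such a space
   extends to [F X] and then to [R (F X)]. On a compact regular frame [<<] is the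
   rather-below relation, which every frame homomorphism preserves and which
   interpolates, so the frame is completely regular; hence
   [a |-> {x | x << a}] corestricts to [CReg] of the ideal frame. Both composites
   are thus (co)reflections onto the compact Hausdorff spaces and the compact
   regular frames, and the (co)algebras of an idempotent (co)monad are its
   (co)reflective objects. *)
Require Import Defs.
From mathcomp Require Import all_boot all_order all_algebra all_classical.
From mathcomp Require Import topology lra.

Set Implicit Arguments.
Unset Strict Implicit.
Unset Printing Implicit Defensive.

Import Order.TTheory GRing.Theory Num.Theory.

Local Open Scope classical_set_scope.
Local Open Scope order_scope.

(** * Categories *)

(** Invertibility inside [S] of an ambient arrow, so that it can be asserted of a unit or counit
    component before that component is packaged as an arrow of [sub_cat S]. *)
Definition sub_iso (C : category) (S : subcategory C) (A B : C) (f : arr A B) :=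
  sub_hom S f /\
  exists g : arr B A, [/\ sub_hom S g, g \oc f = id_arr A & f \oc g = id_arr B].

Lemma sub_isoP (C : category) (S : subcategory C) (A B : sub_cat S)
  (f : arr A B) : sub_iso S (sval f) -> is_iso f.
Proof.
move=> [_ [g [Sg gf fg]]]; exists (exist _ g Sg).
by split; apply: sub_arr_eq.
Qed.

(** Naturality of the restricted unit and counit is inherited, since arrows of a subcategory are
    determined by their underlying arrows. *)
Lemma restricts_to_equivalence_of_iso (C D : category) (F : functor C D)
    (G : functor D C) (adj : adjunction F G)
    (S : subcategory C) (T : subcategory D) :
  maps_sub F S T -> maps_sub G T S ->
  (forall A, sub_ob S A -> sub_iso S (adj_unit adj A)) ->
  (forall B, sub_ob T B -> sub_iso T (adj_counit adj B)) ->
  restricts_to_equivalence adj S T.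
Proof.
move=> FST GTS etaS epsT.
pose eta (A : sub_cat S) :
    arr A ((restrict_functor GTS \of restrict_functor FST) A) :=
  exist _ _ (etaS _ (svalP A)).1.
pose eps (B : sub_cat T) :
    arr ((restrict_functor FST \of restrict_functor GTS) B) B :=
  exist _ _ (epsT _ (svalP B)).1.
have eta_nat (A B : sub_cat S) (f : arr A B) : eta B \oc f
    = fun_arr (restrict_functor GTS \of restrict_functor FST) f \oc eta A.
  by apply: sub_arr_eq; apply: (naturality (adj_unit adj)).
have eps_nat (A B : sub_cat T) (f : arr A B) :
    eps B \oc fun_arr (restrict_functor FST \of restrict_functor GTS) f
    = f \oc eps A.
  by apply: sub_arr_eq; apply: (naturality (adj_counit adj)).
exists FST, GTS.
exists (@NatTrans _ _ (id_functor (sub_cat S)) _ _ eta_nat).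
exists (@NatTrans _ _ _ (id_functor (sub_cat T)) _ eps_nat).
split=> // [A|B]; apply: sub_isoP.
- exact: etaS (svalP A).
- exact: epsT (svalP B).
Qed.

Lemma is_iso_comp (C : category) (A B D : C) (g : arr B D) (f : arr A B) :
  is_iso g -> is_iso f -> is_iso (g \oc f).
Proof.
move=> [g' [g'g gg']] [f' [f'f ff']]; exists (f' \oc g'); split.
  by rewrite -compmA [g' \oc _]compmA g'g comp1m.
by rewrite -compmA [f \oc _]compmA ff' comp1m.
Qed.

Lemma functor_is_iso (C D : category) (F : functor C D) (A B : C) (f : arr A B) :
  is_iso f -> is_iso (fun_arr F f).
Proof.
move=> [g [gf fg]]; exists (fun_arr F g).
by split; rewrite -fmapM ?gf ?fg fmap1.
Qed.

(** * Uniqueness of the unit and counit of an adjunction *)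

Section AdjunctionUniqueness.
Variables (C D : category) (F : functor C D) (G : functor D C).
Implicit Types adj : adjunction F G.

Let adj_inj adj A B (h k : arr (F A) B) :
  fun_arr G h \oc adj_unit adj A = fun_arr G k \oc adj_unit adj A -> h = k.
Proof.
have E (u : arr (F A) B) :
    u = adj_counit adj B \oc fun_arr F (fun_arr G u \oc adj_unit adj A).
  rewrite fmapM compmA -[fun_arr F (fun_arr G u)]/(fun_arr (F \of G) u).
  by rewrite (naturality (adj_counit adj) u) -compmA triangleL compm1.
by move=> hk; rewrite (E h) hk -E.
Qed.

Let coadj_inj adj A B (h k : arr A (G B)) :
  adj_counit adj B \oc fun_arr F h = adj_counit adj B \oc fun_arr F k -> h = k.
Proof.
have E (u : arr A (G B)) :
    u = fun_arr G (adj_counit adj B \oc fun_arr F u) \oc adj_unit adj A.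
  rewrite fmapM -compmA -[fun_arr G (fun_arr F u)]/(fun_arr (G \of F) u).
  by rewrite -(naturality (adj_unit adj) u) compmA triangleR comp1m.
by move=> hk; rewrite (E h) hk -E.
Qed.

Variables adj adj' : adjunction F G.

(** The transpose along [adj2] of the unit of [adj1]; exchanging the two adjunctions gives its
    inverse. *)
Let unit_cmp adj1 adj2 A : arr (F A) (F A) :=
  adj_counit adj2 (F A) \oc fun_arr F (adj_unit adj1 A).

Let unit_cmpE adj1 adj2 A :
  fun_arr G (unit_cmp adj1 adj2 A) \oc adj_unit adj2 A = adj_unit adj1 A.
Proof.
rewrite fmapM -compmA.
rewrite -[fun_arr G (fun_arr F _)]/(fun_arr (G \of F) (adj_unit adj1 A)).
by rewrite -(naturality (adj_unit adj2)) compmA triangleR comp1m.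
Qed.

Let unit_cmpK adj1 adj2 A :
  unit_cmp adj2 adj1 A \oc unit_cmp adj1 adj2 A = id_arr (F A).
Proof.
apply: (adj_inj (adj := adj2)).
by rewrite fmapM -compmA !unit_cmpE fmap1 comp1m.
Qed.

Let counit_cmp adj1 adj2 B : arr (G B) (G B) :=
  fun_arr G (adj_counit adj1 B) \oc adj_unit adj2 (G B).

Let counit_cmpE adj1 adj2 B :
  adj_counit adj2 B \oc fun_arr F (counit_cmp adj1 adj2 B) = adj_counit adj1 B.
Proof.
rewrite fmapM compmA.
rewrite -[fun_arr F (fun_arr G _)]/(fun_arr (F \of G) (adj_counit adj1 B)).
by rewrite (naturality (adj_counit adj2)) -compmA triangleL compm1.
Qed.

Let counit_cmpK adj1 adj2 B :
  counit_cmp adj1 adj2 B \oc counit_cmp adj2 adj1 B = id_arr (G B).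
Proof.
apply: (coadj_inj (adj := adj2)).
by rewrite fmapM compmA !counit_cmpE fmap1 compm1.
Qed.

(** The two units at [A] differ by [G] of an automorphism of [F A], namely [unit_cmp]. *)
Lemma adj_unit_is_iso A :
  is_iso (adj_unit adj A) -> is_iso (adj_unit adj' A).
Proof.
move=> Aiso; rewrite -(unit_cmpE adj' adj A); apply: is_iso_comp => //.
apply: (@functor_is_iso _ _ G _ _ (unit_cmp adj' adj A)).
exists (unit_cmp adj adj' A).
by split; apply: unit_cmpK.
Qed.

Lemma adj_counit_is_iso B :
  is_iso (adj_counit adj B) -> is_iso (adj_counit adj' B).
Proof.
move=> Biso; rewrite -(counit_cmpE adj' adj B); apply: is_iso_comp => //.
apply: (@functor_is_iso _ _ F _ _ (counit_cmp adj' adj B)).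
exists (counit_cmp adj adj' B).
by split; apply: counit_cmpK.
Qed.
End AdjunctionUniqueness.

Lemma full_sub_arr_eq (C : category) (P : C -> Prop) (a b : C)
    (pa pa' : sub_ob (full_sub P) a) (pb pb' : sub_ob (full_sub P) b)
    (f : arr a b) (s s' : sub_hom (full_sub P) f) :
  arr_eq (C := sub_cat (full_sub P)) (A := exist _ a pa) (B := exist _ b pb)
    (exist _ f s) (A' := exist _ a pa') (B' := exist _ b pb') (exist _ f s').
Proof.
rewrite (Prop_irrelevance pa' pa) (Prop_irrelevance pb' pb).
by rewrite (Prop_irrelevance s' s).
Qed.

(** * Algebras of the idempotent monad of a reflection *)

Section ReflectiveMonad.
Variables (C : category) (T : functor C C) (eta : nat_trans (id_functor C) T).
Variable P : C -> Prop.
Hypothesis TP : forall A, P (T A).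
Hypothesis Text :
  forall A B, P B -> forall f : arr A B, exists g : arr (T A) B, g \oc eta A = f.
Hypothesis Tuniq : forall A B, P B ->
  forall g g' : arr (T A) B, g \oc eta A = g' \oc eta A -> g = g'.
Hypothesis Piso : forall A B (f : arr A B), is_iso f -> P A -> P B.

Let ext A B (PB : P B) (f : arr A B) : arr (T A) B := sval (cid (Text PB f)).

Let extE A B (PB : P B) (f : arr A B) : ext PB f \oc eta A = f.
Proof. exact: svalP (cid (Text PB f)). Qed.

Let mult A : arr (T (T A)) (T A) := ext (TP A) (id_arr (T A)).

Let multE A : mult A \oc eta (T A) = id_arr (T A).
Proof. exact: extE. Qed.

Let etaN A B (f : arr A B) : eta B \oc f = fun_arr T f \oc eta A.
Proof. exact: (naturality eta f). Qed.

Let mult_nat A B (f : arr A B) :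
  mult B \oc fun_arr (T \of T) f = fun_arr T f \oc mult A.
Proof.
apply: (Tuniq (TP B)); rewrite -[LHS]compmA -[RHS]compmA multE compm1.
rewrite -[fun_arr (T \of T) f]/(fun_arr T (fun_arr T f)).
by rewrite -etaN compmA multE comp1m.
Qed.

Let mult_nt : nat_trans (T \of T) T := NatTrans mult_nat.

Let mult_eta A : mult A \oc fun_arr T (eta A) = id_arr (T A).
Proof.
by apply: (Tuniq (TP A)); rewrite -compmA -etaN compmA multE comp1m.
Qed.

Let mult_assoc A : mult A \oc fun_arr T (mult A) = mult A \oc mult (T A).
Proof.
by apply: (Tuniq (TP A)); rewrite -!compmA -etaN multE compmA multE comp1m compm1.
Qed.

Let M : monad eta := @Monad _ _ eta mult_nt multE mult_eta mult_assoc.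

(** Both sides agree after the unit; thus the multiplication is invertible, which is idempotency. *)
Let eta_mult A : eta (T A) \oc mult A = id_arr (T (T A)).
Proof. by apply: (Tuniq (TP (T A))); rewrite -compmA multE compm1 comp1m. Qed.

Let M_idem : idempotent_monad M.
Proof. by move=> A; exists (eta (T A)); split; [apply: eta_mult|apply: multE]. Qed.

Let eta_str (A : algebra M) : eta (alg_ob A) \oc alg_str A = id_arr _.
Proof.
apply: (Tuniq (TP (alg_ob A))).
by rewrite -compmA (alg_unit A) compm1 comp1m.
Qed.

(** The structure map is a two-sided inverse of the unit, so the carrier is isomorphic to its
    reflection. *)
Let alg_P (A : algebra M) : P (alg_ob A).
Proof.
apply: (Piso (f := alg_str A)) => //.
by exists (eta (alg_ob A)); rewrite (alg_unit A) eta_str.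
Qed.

Let P_alg_mult A (PA : P A) :
  ext PA (id_arr A) \oc fun_arr T (ext PA (id_arr A))
  = ext PA (id_arr A) \oc mon_mult M A.
Proof.
by apply: (Tuniq PA); rewrite -!compmA -etaN multE compmA extE comp1m compm1.
Qed.

Let P_alg A (PA : P A) : algebra M :=
  @Algebra _ _ _ M A (ext PA (id_arr A)) (extE PA _) (P_alg_mult PA).

Let alg_hom_of A B (PA : P A) (PB : P B) (f : arr A B) :
  f \oc alg_str (P_alg PA) = alg_str (P_alg PB) \oc fun_arr T f.
Proof.
by apply: (Tuniq PB); rewrite -!compmA -etaN !extE compmA extE comp1m compm1.
Qed.

Let toP : functor (alg_cat M) (sub_cat (full_sub P)) :=
  @Functor (alg_cat M) (sub_cat (full_sub P))
    (fun A => exist _ (alg_ob A) (alg_P A))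
    (fun A B f => exist _ (sval f) I)
    (fun A => sub_arr_eq (erefl _)) (fun _ _ _ g f => sub_arr_eq (erefl _)).

Let toAlg : functor (sub_cat (full_sub P)) (alg_cat M).
Proof.
refine (@Functor (sub_cat (full_sub P)) (alg_cat M)
    (fun A => P_alg (svalP A))
    (fun A B f => exist _ (sval f) (alg_hom_of (svalP A) (svalP B) (sval f))) _ _).
- by move=> A; apply: alg_hom_eq.
- by move=> A B D g f; apply: alg_hom_eq.
Defined.

(** With carriers and underlying arrow fixed, equal structure maps leave only proofs to identify,
    which is what the heterogeneous [arr_eq] needs. *)
Let alg_arr_eq (A B : C) (f : arr A B)
    s s' u u' m m' t t' v v' n n' p p' : s = s' -> t = t' ->
  arr_eq (C := alg_cat M)
    (A := @Algebra _ _ _ M A s u m) (B := @Algebra _ _ _ M B t v n)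
    (exist _ f p)
    (A' := @Algebra _ _ _ M A s' u' m') (B' := @Algebra _ _ _ M B t' v' n')
    (exist _ f p').
Proof.
move=> ss tt; subst s' t'.
rewrite (Prop_irrelevance u' u) (Prop_irrelevance m' m) in p' *.
rewrite (Prop_irrelevance v' v) (Prop_irrelevance n' n) in p' *.
by rewrite (Prop_irrelevance p' p).
Qed.

Lemma reflective_monad : exists M : monad eta,
  idempotent_monad M /\ iso_over (alg_forget M) (sub_incl (full_sub P)).
Proof.
exists M; split; first exact: M_idem.
exists toP, toAlg; split.
(* A structure map on an object of [P] is forced: it extends the identity along the unit, as [ext]
   does. *)
- move=> A B f; have sE (D : algebra M) (PD : P (alg_ob D)) :
      alg_str D = ext PD (id_arr (alg_ob D)).
    by apply: (Tuniq PD); rewrite extE; apply: alg_unit.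
  move: f (sE A (svalP (toP A))) (sE B (svalP (toP B))); case: A => A s u m.
  case: B => B t v n [f p] sA sB.
  exact: (alg_arr_eq _ _ (esym sA) (esym sB)).
- by move=> [A pA] [B pB] [f s]; apply: full_sub_arr_eq.
- by move=> A B f.
Qed.
End ReflectiveMonad.

(** * Coalgebras of the idempotent comonad of a coreflection, dually *)

Section CoreflectiveComonad.
Variables (C : category) (T : functor C C) (eps : nat_trans T (id_functor C)).
Variable P : C -> Prop.
Hypothesis TP : forall A, P (T A).
Hypothesis Tlift :
  forall B A, P B -> forall f : arr B A, exists g : arr B (T A), eps A \oc g = f.
Hypothesis Tuniq : forall B A, P B ->
  forall g g' : arr B (T A), eps A \oc g = eps A \oc g' -> g = g'.
Hypothesis Piso : forall A B (f : arr A B), is_iso f -> P A -> P B.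

Let lift B A (PB : P B) (f : arr B A) : arr B (T A) := sval (cid (Tlift PB f)).

Let liftE B A (PB : P B) (f : arr B A) : eps A \oc lift PB f = f.
Proof. exact: svalP (cid (Tlift PB f)). Qed.

Let comult A : arr (T A) (T (T A)) := lift (TP A) (id_arr (T A)).

Let comultE A : eps (T A) \oc comult A = id_arr (T A).
Proof. exact: liftE. Qed.

Let epsN A B (f : arr A B) : eps B \oc fun_arr T f = f \oc eps A.
Proof. exact: (naturality eps f). Qed.

Let comult_nat A B (f : arr A B) :
  comult B \oc fun_arr T f = fun_arr (T \of T) f \oc comult A.
Proof.
apply: (Tuniq (TP A)); rewrite [LHS]compmA [RHS]compmA comultE comp1m.
rewrite -[fun_arr (T \of T) f]/(fun_arr T (fun_arr T f)).
by rewrite epsN -compmA comultE compm1.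
Qed.

Let comult_nt : nat_trans T (T \of T) :=
  @NatTrans _ _ T (T \of T) comult comult_nat.

Let comult_eps A : fun_arr T (eps A) \oc comult A = id_arr (T A).
Proof.
by apply: (Tuniq (TP A)); rewrite compmA epsN -compmA comultE compm1.
Qed.

Let comult_assoc A :
  fun_arr T (comult A) \oc comult A = comult (T A) \oc comult A.
Proof.
apply: (Tuniq (TP A)); rewrite [LHS]compmA [RHS]compmA epsN -[LHS]compmA.
by rewrite !comultE comp1m compm1.
Qed.

Let W : comonad eps := @Comonad _ _ eps comult_nt comultE comult_eps comult_assoc.

Let comult_eps' A : comult A \oc eps (T A) = id_arr (T (T A)).
Proof. by apply: (Tuniq (TP (T A))); rewrite compmA comultE compm1 comp1m. Qed.

Let W_idem : idempotent_comonad W.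
Proof.
by move=> A; exists (eps (T A)); split; [apply: comultE|apply: comult_eps'].
Qed.

Let str_eps (A : coalgebra W) : coalg_str A \oc eps (coalg_ob A) = id_arr _.
Proof.
apply: (Tuniq (TP (coalg_ob A))).
by rewrite compmA (coalg_counit A) compm1 comp1m.
Qed.

Let coalg_P (A : coalgebra W) : P (coalg_ob A).
Proof.
apply: (Piso (f := eps (coalg_ob A))) => //.
by exists (coalg_str A); rewrite (coalg_counit A) str_eps.
Qed.

Let P_coalg_comult A (PA : P A) :
  fun_arr T (lift PA (id_arr A)) \oc lift PA (id_arr A)
  = com_comult W A \oc lift PA (id_arr A).
Proof.
by apply: (Tuniq PA); rewrite !compmA epsN comultE -compmA liftE comp1m compm1.
Qed.

Let P_coalg A (PA : P A) : coalgebra W :=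
  @Coalgebra _ _ _ W A (lift PA (id_arr A)) (liftE PA _) (P_coalg_comult PA).

Let coalg_hom_of A B (PA : P A) (PB : P B) (f : arr A B) :
  coalg_str (P_coalg PB) \oc f = fun_arr T f \oc coalg_str (P_coalg PA).
Proof.
by apply: (Tuniq PA); rewrite !compmA epsN !liftE -compmA liftE comp1m compm1.
Qed.

Let toP : functor (coalg_cat W) (sub_cat (full_sub P)) :=
  @Functor (coalg_cat W) (sub_cat (full_sub P))
    (fun A => exist _ (coalg_ob A) (coalg_P A))
    (fun A B f => exist _ (sval f) I)
    (fun A => sub_arr_eq (erefl _)) (fun _ _ _ g f => sub_arr_eq (erefl _)).

Let toCoalg : functor (sub_cat (full_sub P)) (coalg_cat W).
Proof.
refine (@Functor (sub_cat (full_sub P)) (coalg_cat W)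
    (fun A => P_coalg (svalP A))
    (fun A B f => exist _ (sval f) (coalg_hom_of (svalP A) (svalP B) (sval f))) _ _).
- by move=> A; apply: coalg_hom_eq.
- by move=> A B D g f; apply: coalg_hom_eq.
Defined.

Let coalg_arr_eq (A B : C) (f : arr A B)
    s s' u u' m m' t t' v v' n n' p p' : s = s' -> t = t' ->
  arr_eq (C := coalg_cat W)
    (A := @Coalgebra _ _ _ W A s u m) (B := @Coalgebra _ _ _ W B t v n)
    (exist _ f p)
    (A' := @Coalgebra _ _ _ W A s' u' m') (B' := @Coalgebra _ _ _ W B t' v' n')
    (exist _ f p').
Proof.
move=> ss tt; subst s' t'.
rewrite (Prop_irrelevance u' u) (Prop_irrelevance m' m) in p' *.
rewrite (Prop_irrelevance v' v) (Prop_irrelevance n' n) in p' *.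
by rewrite (Prop_irrelevance p' p).
Qed.

Lemma coreflective_comonad : exists W : comonad eps,
  idempotent_comonad W /\ iso_over (coalg_forget W) (sub_incl (full_sub P)).
Proof.
exists W; split; first exact: W_idem.
exists toP, toCoalg; split.
- move=> A B f; have sE (D : coalgebra W) (PD : P (coalg_ob D)) :
      coalg_str D = lift PD (id_arr (coalg_ob D)).
    by apply: (Tuniq PD); rewrite liftE; apply: coalg_counit.
  move: f (sE A (svalP (toP A))) (sE B (svalP (toP B))); case: A => A s u m.
  case: B => B t v n [f p] sA sB.
  exact: (coalg_arr_eq _ _ (esym sA) (esym sB)).
- by move=> [A pA] [B pB] [f s]; apply: full_sub_arr_eq.
- by move=> A B f.
Qed.
End CoreflectiveComonad.

(** * Stably compact frames *)

Section WayBelowTheory.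
Context {d : Order.disp_t} {L : frameType d}.
Implicit Types (a b x y : L) (S : set L) (J : ideals L).

Lemma subset_fsup S S' : (S `<=` S')%classic -> fsup S <= fsup S'.
Proof. by move=> SS'; apply/fsup_leP => x /SS'; apply: fsup_ub. Qed.

Lemma fsup_setU1 x S : fsup (x |` S)%classic = x `|` fsup S.
Proof.
apply: le_anti; apply/andP; split.
  by apply/fsup_leP => y [->|Sy]; rewrite ?leUl // lexUr // fsup_ub.
rewrite leUx fsup_ub /=; last by left.
by apply: subset_fsup => y; right.
Qed.

Lemma ideal_fsup_finite J S :
  finite_set S -> (S `<=` iset J)%classic -> iset J (fsup S).
Proof.
have [J0 _ Jj] := isetP J; move=> /finite_seqP[s ->].
elim: s => [|x s IHs] sJ; first by rewrite set_nil fsup0.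
have -> : [set` x :: s] = (x |` [set` s])%classic.
  by apply/seteqP; split=> y /=; rewrite inE => /predU1P.
rewrite fsup_setU1; apply: Jj.
  by apply: sJ; rewrite /= mem_head.
by apply: IHs => y /= ys; apply: sJ; rewrite /= inE ys orbT.
Qed.

(** The ideal generated by [S]. *)
Let finite_joins S : set L :=
  [set x | exists G, [/\ finite_set G, (G `<=` S)%classic & x <= fsup G]].

Let finite_joins_ideal S : is_ideal (finite_joins S).
Proof.
split=> [|a b ab [G [Gf GS bG]]|a b [G [Gf GS aG]] [H [Hf HS bH]]].
- by exists set0; split=> //; rewrite le0x.
- by exists G; split=> //; apply: le_trans bG.
- exists (G `|` H)%classic; split; first by rewrite finite_setU.
    by move=> x [/GS|/HS].
  rewrite leUx (le_trans aG) ?(le_trans bH) //; apply: subset_fsup => x.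
    by right.
  by left.
Qed.

(** A cover may be replaced by the ideal it generates, whose members are exactly the elements below
    a finite subjoin. *)
Lemma way_belowP a b :
  way_below a b <-> forall J, b <= fsup (iset J) -> iset J a.
Proof.
split=> [ab J bJ|abJ S bS].
  have [G [Gf GJ aG]] := ab _ bJ; have [_ Jd _] := isetP J.
  exact: Jd aG (ideal_fsup_finite Gf GJ).
suff [G [Gf GS aG]] : finite_joins S a by exists G.
apply: (abJ (Ideal (finite_joins_ideal S))); apply: (le_trans bS).
apply: subset_fsup => x Sx; exists [set x]; split=> //.
  by move=> _ ->.
exact: fsup_ub.
Qed.

Let down_ideal b : is_ideal [set x | x <= b].
Proof.
split=> /= [|x y xy yb|x y xb yb]; first exact: le0x.
  exact: le_trans yb.
by rewrite leUx xb yb.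
Qed.

Lemma way_below_le a b : way_below a b -> a <= b.
Proof.
by move=> /way_belowP/(_ (Ideal (down_ideal b))); apply; apply: fsup_ub => /=.
Qed.

Lemma way_below_mono a a' b b' :
  a' <= a -> b <= b' -> way_below a b -> way_below a' b'.
Proof.
move=> aa bb /way_belowP ab; apply/way_belowP => J bJ.
by have [_ Jd _] := isetP J; apply: Jd aa (ab _ (le_trans bb bJ)).
Qed.

Lemma way_below_bot a : way_below \bot a.
Proof. by apply/way_belowP => J _; case: (isetP J). Qed.

Lemma way_below_join a b a' b' :
  way_below a b -> way_below a' b' -> way_below (a `|` a') (b `|` b').
Proof.
move=> /way_belowP ab /way_belowP ab'; apply/way_belowP => J.
rewrite leUx => /andP[bJ bJ']; have [_ _ Jj] := isetP J.
by apply: Jj; [apply: ab|apply: ab'].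
Qed.

Lemma way_below_sublatticeP : way_below (\top : L) \top ->
  (forall a b a' b', way_below a b -> way_below a' b' ->
     way_below (a `&` a') (b `&` b')) -> way_below_sublattice L.
Proof.
by split=> //; [apply: way_below_bot|apply: way_below_join].
Qed.

Let way_below_is_ideal b : is_ideal [set x | way_below x b].
Proof.
split=> /= [|x y xy|x y xb yb]; first exact: way_below_bot.
  exact: way_below_mono.
by rewrite -[b]joinxx; apply: way_below_join.
Qed.

Definition way_below_ideal b : ideals L := Ideal (way_below_is_ideal b).

Section Continuous.
Hypothesis Lcont : forall a, a = fsup [set x | way_below x a].

(** By continuity each member of [S] is the join of the elements way below it, so upper bounds can
    be tested on those. *)
Lemma fsup_way_below S b :
  fsup S <= b <-> forall s x, S s -> way_below x s -> x <= b.
Proof.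
split=> [/fsup_leP Sb s x Ss xs|Sb].
  exact: le_trans (way_below_le xs) (Sb _ Ss).
apply/fsup_leP => s Ss; rewrite (Lcont s); apply/fsup_leP => x; exact: Sb.
Qed.

(** The elements way below something way below [b] form an ideal, whose join reaches [b] by
    continuity used twice; hence it contains [a]. *)
Lemma way_below_interpolation a b :
  way_below a b -> exists2 x, way_below a x & way_below x b.
Proof.
move=> /way_belowP ab; pose J x := exists2 y, way_below x y & way_below y b.
have JJ : is_ideal J.
  split=> [|x y xy [z yz zb]|x y [z xz zb] [w yw wb]].
  - by exists \bot; apply: way_below_bot.
  - by exists z => //; apply: way_below_mono yz.
  - exists (z `|` w); first exact: way_below_join.
    by rewrite -[b]joinxx; apply: way_below_join.
apply: (ab (Ideal JJ)); rewrite {1}(Lcont b).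
by apply/fsup_way_below => y x yb xy; apply: fsup_ub; exists y.
Qed.
End Continuous.
End WayBelowTheory.

(** * Separation by prime filters *)

Section PrimeFilters.
Context {d : Order.disp_t} {L : tbDistrLatticeType d}.
Implicit Types (a b x y : L) (p q : set L).

Let extend_filter p x : set L := [set z | exists2 w, p w & w `&` x <= z].

Let extend_filterP p x : lattice_filter p -> lattice_filter (extend_filter p x).
Proof.
move=> [p1 pup pm]; split=> [|a b ab [w pw wa]|a b [w pw wa] [v pv vb]].
- by exists \top => //; apply: lex1.
- by exists w => //; apply: le_trans ab.
- exists (w `&` v); first exact: pm.
  by rewrite lexI (le_trans _ wa) ?(le_trans _ vb) // leI2 ?leIl ?leIr.
Qed.

(** Zorn's lemma yields a filter maximal among those containing [p] and avoiding [b]. If it missed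
    both [x] and [y], adjoining either would force [b], and by distributivity it could not contain
    their join. *)
Lemma prime_filter_separation p b : lattice_filter p -> ~ p b ->
  exists q, [/\ is_prime_filter q, (p `<=` q)%classic & ~ q b].
Proof.
move=> pF pb.
(* The union with [p] takes care of the empty chain. *)
pose Q := [set q | lattice_filter (p `|` q)%classic /\ ~ (p `|` q)%classic b].
have [p1 pup pm] := pF.
have Qchain (F : set (set L)) : (F `<=` Q)%classic -> total_on F subset ->
    Q (\bigcup_(q in F) q).
  move=> FQ Ftot; split; last first.
    by move=> [//|[q Fq qb]]; have [_ []] := FQ _ Fq; right.
  split=> [|x y xy [px|[q Fq qx]]|x y]; first by left.
  - by left; apply: pup px.
  - have [[_ up _] _] := FQ _ Fq.
    have [|py|qy] := up _ _ xy; [by right|by left|by right; exists q].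
  - have inQ q : F q -> (p `|` q)%classic x -> (p `|` q)%classic y ->
        (p `|` \bigcup_(q in F) q)%classic (x `&` y).
      move=> Fq xq yq; have [[_ _ m] _] := FQ _ Fq.
      by have [pxy|qxy] := m _ _ xq yq; [left|right; exists q].
    move=> [px|[q Fq qx]] [py|[q' Fq' qy]]; first by left; apply: pm.
    + by apply: (inQ q') => //; [left|right].
    + by apply: (inQ q) => //; [right|left].
    + have [qq|qq] := Ftot _ _ Fq Fq'.
        by apply: (inQ q') => //; right => //; apply: qq.
      by apply: (inQ q) => //; right => //; apply: qq.
have [q [[qF qb] qmax]] := Zorn_bigcup Qchain.
set m := (p `|` q)%classic in qF qb.
have [m1 mup mm] := qF.
(* The filter generated by [m] and [x] strictly contains [q], so by maximality it cannot avoid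
   [b]. *)
have extend x : ~ m x -> extend_filter m x b.
  move=> mx; apply: contrapT => xb.
  have pE : (p `|` extend_filter m x = extend_filter m x)%classic.
    by apply/setUidr => z pz; exists z; [left|apply: leIl].
  apply: (qmax (extend_filter m x)); last first.
    by split; rewrite pE //; apply: extend_filterP.
  split; last first.
    move=> /(_ x) xq; apply: mx; right; apply: xq.
    by exists \top => //; apply: leIr.
  by move=> z qz; exists z; [right|apply: leIl].
exists m; split=> //; last by move=> z; left.
split; first by split=> // m0; apply: qb; apply: mup m0; apply: le0x.
move=> x y mxy; apply: contrapT => /not_orP[/extend[w mw wx] /extend[v mv vy]].
apply: qb; apply: mup (mm _ _ (mm _ _ mw mv) mxy).
rewrite meetUr leUx (le_trans _ wx) ?(le_trans _ vy) // leI2 ?leIl ?leIr //.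
Qed.
End PrimeFilters.

(** * Points of a stably compact frame *)

Section StablyCompact.
Context {d : Order.disp_t} {L : frameType d}.
Hypothesis Lsc : stably_compact_frame L.
Implicit Types (a b x y : L) (p : set L).

Let Lcont a : a = fsup [set x | way_below x a]. Proof. exact: Lsc.2. Qed.
Let wb_top : way_below (\top : L) \top. Proof. by case: Lsc.1. Qed.
Let wb_meet a b a' b' : way_below a b -> way_below a' b' ->
  way_below (a `&` a') (b `&` b').
Proof. by case: Lsc.1 => _ _ + _; apply. Qed.

(** Compactness gives the top element, the sublattice condition gives closure under meets. *)
Lemma way_below_filter x : lattice_filter [set y | way_below x y].
Proof.
split=> /= [|y z yz|y z xy xz].
- by apply: way_below_mono wb_top => //; apply: lex1.
- exact: way_below_mono.
- by rewrite -[x]meetxx; apply: wb_meet.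
Qed.

Section PointOfPrimeFilter.
Variables (p : set L) (pP : is_prime_filter p).

Let p1 : p \top. Proof. by case: pP => -[[]]. Qed.
Let pup a b : a <= b -> p a -> p b.
Proof. by case: pP => -[[_ + _]] _ _; apply. Qed.
Let pm a b : p a -> p b -> p (a `&` b).
Proof. by case: pP => -[[_ _ +]] _ _; apply. Qed.
Let p0 : ~ p \bot. Proof. by case: pP => -[]. Qed.
Let pprime a b : p (a `|` b) -> p a \/ p b.
Proof. by case: pP => _; apply. Qed.

Definition prime_filter_point : frame_hom L bool.
Proof.
refine (@FrameHom _ _ L bool (fun c => `[< exists2 y, way_below y c & p y >]) _ _ _).
- by apply/asboolP; exists \top.
- move=> a b; rewrite -[RHS]asbool_and; apply: asbool_equiv_eq; split.
    move=> [y yab py]; split; exists y => //; apply: way_below_mono yab => //.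
      exact: leIl.
    exact: leIr.
  by move=> [[y ya py] [z zb pz]]; exists (y `&` z); [apply: wb_meet|apply: pm].
- move=> S; apply: asbool_equiv_eq; split; last first.
    move=> [s Ss /asboolP[y ys py]]; exists y => //.
    by apply: way_below_mono ys => //; apply: fsup_ub.
  move=> [y /way_belowP yS py].
  (* Properness of [p] puts the bottom in this ideal and primeness closes it under joins. By
     continuity it covers [fsup S], so it contains [y], which lies in [p]. *)
  pose J x := p x -> exists2 s, S s & exists2 z, way_below z s & p z.
  have JJ : is_ideal J.
    split=> [/p0 //|a b ab Jb pa|a b Ja Jb /pprime[]//].
    by apply: Jb; apply: pup pa.
  have [|s Ss sz] := yS (Ideal JJ) _ py; last by exists s => //; apply/asboolP.
  apply/(fsup_way_below Lcont) => s z Ss zs; apply: fsup_ub => pz.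
  by exists s => //; exists z.
Defined.

Lemma prime_filter_pointP c :
  prime_filter_point c <-> exists2 y, way_below y c & p y.
Proof. by split=> /asboolP. Qed.
End PointOfPrimeFilter.

(** The prime filter extends the elements way above [x] and omits [b]. Interpolation makes its point
    true on all of the former; it is false at [b] because anything way below [b] is below [b]. *)
Lemma way_below_point_separation x b : ~ way_below x b ->
  exists2 f : frame_hom L bool, forall y, way_below x y -> f y & ~~ f b.
Proof.
move=> xb; have [p [pP xp pb]] := prime_filter_separation (way_below_filter x) xb.
exists (prime_filter_point pP) => [y xy|].
  apply/prime_filter_pointP.
  have [z xz zy] := way_below_interpolation Lcont xy.
  by exists z => //; apply: xp.
apply/negP => /prime_filter_pointP[y yb py]; apply: pb.
by have [[[_ up _] _] _] := pP; apply: up (way_below_le yb) py.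
Qed.

Lemma point_separation a b : ~~ (a <= b) ->
  exists2 f : frame_hom L bool, f a & ~~ f b.
Proof.
move=> ab; have [x xa xb] : exists2 x, way_below x a & ~ way_below x b.
  apply: contrapT => H; move/negP: ab; apply; rewrite (Lcont a).
  apply/fsup_leP => x xa; apply: way_below_le; apply: contrapT => xb.
  by apply: H; exists x.
by have [f fx fb] := way_below_point_separation xb; exists f => //; apply: fx.
Qed.

(** A section of the join map [ideal_counit]: compactness preserves the top, the sublattice
    condition the meets, continuity the joins. *)
Definition way_below_hom : frame_hom L (ideals L).
Proof.
refine (@FrameHom _ _ L (ideals L) (@way_below_ideal _ L) _ _ _).
- by apply/ideal_topP.
- move=> a b; apply: ideals_eq; apply/seteqP; split=> x /=.
    by move=> xab; split; apply: way_below_mono xab; rewrite ?leIl ?leIr.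
  by move=> [xa xb]; rewrite -[x]meetxx; apply: wb_meet.
- move=> S; apply: le_anti; apply/andP; split; last first.
    apply/fsup_leP => _ [a Sa <-]; apply/ideals_leP => x /=.
    by apply: way_below_mono => //; apply: fsup_ub.
  apply/ideals_leP => x /way_belowP; apply.
  apply/(fsup_way_below Lcont) => s y Ss ys; apply: fsup_ub.
  by apply: (ideals_sup_sub (K := way_below_ideal s)) => //; exists s.
Defined.

Lemma way_below_homK a : ideal_counit L (way_below_hom a) = a.
Proof. exact: esym (Lcont a). Qed.
End StablyCompact.

(** * Isomorphisms of frames *)

Section FrameIso.
Context {d d' : Order.disp_t} {L : frameType d} {M : frameType d'}.

Lemma frame_hom_bij (h : frame_hom L M) : injective h ->
  (forall y, exists x, h x = y) ->
  exists g : frame_hom M L, cancel h g /\ cancel g h.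
Proof.
move=> hinj hsurj; pose g y := sval (cid (hsurj y)).
have gK : cancel g h by move=> y; apply: (svalP (cid (hsurj y))).
have hK : cancel h g by move=> x; apply: hinj; rewrite gK.
unshelve eexists (@FrameHom _ _ M L g _ _ _); last by [].
- by apply: hinj; rewrite gK fhom_top.
- by move=> a b; apply: hinj; rewrite fhom_meet !gK.
- move=> S; apply: hinj; rewrite gK fhom_sup image_comp.
  by rewrite (eq_imagel (f := h \o g) (f' := id)) ?image_id // => y _ /=; rewrite gK.
Qed.

Variables (h : frame_hom L M) (g : frame_hom M L).
Hypotheses (hK : cancel h g) (gK : cancel g h).

(** An ideal covering [h b] pulls back along [h] to an ideal covering [b]. *)
Lemma iso_proper : proper_frame_hom h.
Proof.
move=> a b /way_belowP ab; apply/way_belowP => J bJ.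
have [J0 Jd Jj] := isetP J.
have JJ : is_ideal [set x | iset J (h x)].
  split=> /= [|x y xy|x y]; first by rewrite fhom_bot.
    by apply: Jd; apply: fhom_le.
  by rewrite fhom_join; apply: Jj.
apply: (ab (Ideal JJ)); rewrite -[b]hK; apply: le_trans (fhom_le g bJ) _.
rewrite fhom_sup; apply/fsup_leP => _ [y Jy <-]; apply: fsup_ub => /=.
by rewrite gK.
Qed.

Lemma iso_regular : regular_frame L -> regular_frame M.
Proof.
move=> Lreg b; apply: le_anti; apply/andP; split; last first.
  by apply/fsup_leP => x; apply: rather_below_le.
rewrite -{1}[b]gK [g b]Lreg fhom_sup; apply/fsup_leP => _ [x xb <-].
by apply: fsup_ub; rewrite /= -[b]gK; apply: fhom_rather_below.
Qed.
End FrameIso.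

(** * Compact regular frames *)

Section CompactRegular.
Context {d : Order.disp_t} {L : frameType d}.
Implicit Types (a b x y : L).

Lemma rather_below_bot a : rather_below \bot a.
Proof. by exists \top; rewrite meet0x join1x. Qed.

Lemma rather_below_join a b a' b' : rather_below a b -> rather_below a' b' ->
  rather_below (a `|` a') (b `|` b').
Proof.
move=> [c [ac cb]] [c' [ac' cb']]; exists (c `&` c'); split.
  by rewrite meetUl meetA ac meet0x meetCA ac' meetx0 joinxx.
rewrite joinIl joinA cb join1x (joinC b) joinA cb' join1x meetxx //.
Qed.

(** If [J] covers [b], the elements whose meet with [a] lies in [J] form an ideal containing both
    [J] and the witness [c]. It covers the top, so by compactness it contains the top, that is, [a]
    is in [J]. *)
Lemma compact_way_below a b :
  compact_frame L -> rather_below a b -> way_below a b.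
Proof.
move=> /way_belowP Lc [c [ac cb]]; apply/way_belowP => J bJ.
have [J0 Jd Jj] := isetP J.
have JJ : is_ideal [set x | iset J (x `&` a)].
  split=> /= [|x y xy|x y Jx Jy]; first by rewrite meet0x.
    by apply: Jd; apply: leI2.
  by rewrite meetUl; apply: Jj.
have /= := Lc (Ideal JJ); rewrite meet1x; apply.
rewrite -cb leUx fsup_ub /=; last by rewrite meetC ac.
apply: (le_trans bJ); apply: subset_fsup => x Jx.
by apply: Jd Jx; apply: leIl.
Qed.

(** The elements rather below [b] form an ideal, with join [b] by regularity. *)
Lemma regular_rather_below a b :
  regular_frame L -> way_below a b -> rather_below a b.
Proof.
move=> Lreg /way_belowP ab.
have JJ : is_ideal [set x | rather_below x b].
  split=> /= [|x y xy|x y xb yb]; first exact: rather_below_bot.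
    exact: rather_below_mono.
  by rewrite -[b]joinxx; apply: rather_below_join.
by apply: (ab (Ideal JJ)); rewrite /= -Lreg.
Qed.

Lemma creg_regular : completely_regular_frame L -> regular_frame L.
Proof.
move=> Lcreg a; apply: le_anti; apply/andP; split; last first.
  by apply/fsup_leP => x; apply: rather_below_le.
rewrite {1}(Lcreg a); apply: subset_fsup => x [s [<- <- sP]].
exact: sP.
Qed.

Hypotheses (Lcomp : compact_frame L) (Lreg : regular_frame L).

Lemma rather_belowE a b : rather_below a b <-> way_below a b.
Proof. by split; [apply: compact_way_below|apply: regular_rather_below]. Qed.

Lemma compact_regular_stably_compact : stably_compact_frame L.
Proof.
split; last first.
  move=> a; rewrite {1}(Lreg a); congr fsup.
  by apply/seteqP; split=> x /rather_belowE.
apply: way_below_sublatticeP => // a b a' b' /rather_belowE ab /rather_belowE ab'.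
by apply/rather_belowE; apply: rather_below_meet.
Qed.
End CompactRegular.

Lemma compact_regular_proper d d' (L : frameType d) (M : frameType d')
    (h : frame_hom L M) : compact_frame L -> regular_frame L ->
  compact_frame M -> proper_frame_hom h.
Proof.
move=> Lc Lreg Mc a b /(rather_belowE Lc Lreg) ab.
by apply: compact_way_below => //; apply: fhom_rather_below.
Qed.

(** * Complete regularity by dyadic interpolation *)

Section DyadicScale.
Context {d : Order.disp_t} {L : frameType d}.
Variables (f : L -> L -> L) (a b : L).
Hypothesis fP : forall x y, rather_below x y ->
  rather_below x (f x y) /\ rather_below (f x y) y.
Hypothesis ab : rather_below a b.

(* [dyadic n k] is the value of the scale at [k / 2 ^ n], for [k <= 2 ^ n]. *)
Let dyadic := fix dyadic (n k : nat) : L :=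
  if n is m.+1 then
    if odd k then f (dyadic m k./2) (dyadic m k./2.+1) else dyadic m k./2
  else if k is 0%N then a else b.

Let dyadicS n k : (k < 2 ^ n)%N -> rather_below (dyadic n k) (dyadic n k.+1).
Proof.
elim: n k => [|n IHn] k; first by case: k.
rewrite expnS mul2n => kn /=; rewrite uphalf_half.
have {}IHn : rather_below (dyadic n k./2) (dyadic n k./2.+1).
  by apply: IHn; rewrite ltn_half_double.
by have [] := fP IHn; case: (odd k).
Qed.

Let dyadic0 n : dyadic n 0 = a. Proof. by elim: n. Qed.

Let dyadic1 n : dyadic n (2 ^ n) = b.
Proof. by elim: n => //= n IHn; rewrite expnS mul2n odd_double doubleK. Qed.

Let dyadic_le n k l : (k <= l <= 2 ^ n)%N -> dyadic n k <= dyadic n l.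
Proof.
elim: l => [|l IHl]; first by case: k.
rewrite leq_eqVlt => /andP[/orP[/eqP-> //|kl] ln].
apply: (@le_trans _ _ (dyadic n l)); last exact/rather_below_le/dyadicS.
by apply: IHl; rewrite -ltnS kl ltnW.
Qed.

Let dyadic_lift n k i : dyadic (i + n) (k * 2 ^ i) = dyadic n k.
Proof.
elim: i => [|i IHi]; first by rewrite muln1.
by rewrite expnS mulnCA mul2n /= odd_double doubleK.
Qed.

(** The fractions [j / 2 ^ m] and [k / 2 ^ n] are compared after lifting both to level [m + n]. *)
Let dyadic_cmp m j n k : (k <= 2 ^ n)%N -> (j * 2 ^ n <= k * 2 ^ m)%N ->
  dyadic m j <= dyadic n k.
Proof.
move=> kn jk; rewrite -(dyadic_lift m j n) -(dyadic_lift n k m) addnC.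
by apply: dyadic_le; rewrite jk addnC expnD leq_mul2r kn orbT.
Qed.

(** Extends the dyadic values to the rationals from below; the bound on [k] keeps to the range where
    [dyadic] is monotone. *)
Let scale (q : rat) : L := fsup [set x | exists n k,
  [/\ (k <= 2 ^ n)%N, (k%:R <= q * 2 ^+ n)%R & x = dyadic n k]].

Let dyadic_between (p q : rat) : (0 <= p)%R -> (p < q)%R ->
  exists n k : nat, (p * 2 ^+ n <= k%:R)%R /\ (k.+1%:R <= q * 2 ^+ n)%R.
Proof.
(* This makes [2 ^ n] at least [2 / (q - p)], so the interval scaled by [2 ^ n] has length at least
   2 and contains the two integers following the integer part of its left end. *)
move=> p0 pq; pose n := (Num.truncn (2 / (q - p))%R).+1.
exists n, (Num.truncn (p * 2 ^+ n)%R).+1.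
have n2 : (2 / (q - p) <= 2 ^+ n :> rat)%R.
  apply: ltW; apply: (@lt_trans _ _ (n%:R)%R); first exact: truncnS_gt.
  by rewrite -natrX ltr_nat ltn_expl.
have p2n : (0 <= p * 2 ^+ n)%R by rewrite mulr_ge0 ?exprn_ge0.
split; first exact/ltW/truncnS_gt.
have := truncn_le (p * 2 ^+ n)%R; rewrite p2n => pn.
move: n2; rewrite ler_pdivrMr ?subr_gt0 // => n2.
rewrite -!natr1; move: (Num.truncn _)%:R%R pn => t pn.
move: (2 ^+ n)%R n2 pn => {p2n n} e n2 pn; lra.
Qed.

Lemma completely_below_dyadic : completely_below a b.
Proof.
exists scale; split.
- apply: le_anti; apply/andP; split; last first.
    by apply: fsup_ub; exists 0%N, 0%N; split=> //; rewrite mul0r.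
  apply/fsup_leP => _ [n [k [_ + ->]]].
  by rewrite mul0r lern0 => /eqP ->; rewrite dyadic0.
- apply: le_anti; apply/andP; split; last first.
    by apply: fsup_ub; exists 0%N, 1%N; split.
  apply/fsup_leP => _ [n [k [kn _ ->]]].
  by rewrite -(dyadic1 n); apply: dyadic_le; rewrite kn leqnn.
(* Between [p] and [q] lie two consecutive dyadics: the value at the first bounds [scale p], and the
   value at the second is a term of [scale q]. *)
- move=> p q p0 pq q1; have [n [k [pk kq]]] := dyadic_between p0 pq.
  have kn : (k < 2 ^ n)%N.
    rewrite -(ler_nat rat) (le_trans kq) // natrX.
    by rewrite ler_piMl ?exprn_ge0.
  apply: rather_below_mono (dyadicS kn).
    apply/fsup_leP => _ [m [j [jm jp ->]]]; apply: dyadic_cmp; first exact: ltnW.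
    rewrite -(ler_nat rat) !natrM !natrX.
    apply: (@le_trans _ _ (p * 2 ^+ m * 2 ^+ n)%R).
      by rewrite ler_wpM2r ?exprn_ge0.
    by rewrite mulrAC ler_wpM2r ?exprn_ge0.
  by apply: fsup_ub; exists n, k.+1.
Qed.
End DyadicScale.

Lemma compact_regular_creg d (L : frameType d) :
  compact_frame L -> regular_frame L -> completely_regular_frame L.
Proof.
move=> Lc Lreg; have [_ Lcont] := compact_regular_stably_compact Lc Lreg.
(* Choice makes the interpolant a function of the pair, as the dyadic recursion requires; pairs not
   related by rather-below get the dummy value [x]. *)
have /choice[f fP] : forall xy : L * L, exists z, rather_below xy.1 xy.2 ->
    rather_below xy.1 z /\ rather_below z xy.2.
  move=> [x y] /=; case: (pselect (rather_below x y)) => [xy|]; last by exists x.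
  have [z xz zy] := way_below_interpolation Lcont ((rather_belowE Lc Lreg _ _).1 xy).
  by exists z => _; split; apply/(rather_belowE Lc Lreg).
move=> a; apply: cregularP; rewrite {1}(Lreg a); apply: subset_fsup => x xa.
apply: (completely_below_dyadic (f := fun y z => f (y, z))) => // y z.
by move=> /(fP (y, z)).
Qed.

(** * The coreflection onto compact regular frames *)

Lemma compact_creg d (L : frameType d) : compact_frame L -> compact_frame (creg L).
Proof.
move=> /way_belowP Lc; apply/way_belowP => J.
rewrite creg_leE creg_val_top creg_val_sup => J1.
have [J0 Jd Jj] := isetP J.
(* The ideal of [L] generated by [J], to which compactness of [L] applies. *)
have JJ : is_ideal [set x | exists2 y, iset J y & x <= creg_val y].
  split=> /= [|x y xy [z Jz yz]|x y [z Jz xz] [w Jw yw]].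
  - by exists \bot => //; apply: le0x.
  - by exists z => //; apply: le_trans yz.
  - exists (z `|` w); first exact: Jj.
    by rewrite -[creg_val _]/(creg_incl L _) fhom_join leU2.
have [|y Jy] := Lc (Ideal JJ).
  by apply: (le_trans J1); apply/fsup_leP => _ [y Jy <-]; apply: fsup_ub; exists y.
by rewrite -creg_val_top -creg_leE; move=> y1; apply: Jd y1 Jy.
Qed.

(** The union of an ideal of ideals is directed, hence an ideal; if it is everything, one member
    contains the top. *)
Lemma compact_ideals d (L : frameType d) : compact_frame (ideals L).
Proof.
apply/way_belowP => J /ideals_leP; rewrite iset_top => J1.
have [J0 Jd Jj] := isetP J.
have JJ : is_ideal [set x : L | exists2 K, iset J K & iset K x].
  split=> /= [|x y xy [K JK Ky]|x y [K JK Kx] [H JH Hy]].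
  - by exists \bot => //; case: (isetP (\bot : ideals L)).
  - by exists K => //; have [_ Kd _] := isetP K; apply: Kd Ky.
  - exists (K `|` H); first exact: Jj.
    have [_ _ j] := isetP (K `|` H); apply: j.
      by have /ideals_leP := leUl K H; apply.
    by have /ideals_leP := leUr H K; apply.
have sJ : (iset (ideals_sup (iset J)) `<=` iset (Ideal JJ))%classic.
  by apply/ideals_sup_le => K JK x Kx; exists K.
by have [K JK /ideal_topP K1] := sJ \top (J1 _ I); rewrite -K1.
Qed.

(** If [c] witnesses that [x] is rather below [a], density forces [u x] and [v c] to be disjoint, so
    [u x] is below [v a]; regularity takes the join over [x]. *)
Lemma dense_hom_inj d d' d'' (L : frameType d) (M : frameType d')
    (N : frameType d'') (k : frame_hom M N) (g h : frame_hom L M) :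
  regular_frame L -> (forall x, k x = \bot -> x = \bot) ->
  (forall x, k (g x) = k (h x)) -> g = h.
Proof.
move=> Lreg kd kgh.
suff le (u v : frame_hom L M) : (forall x, k (u x) = k (v x)) ->
    forall a, u a <= v a.
  by apply: frame_hom_eq => a; apply: le_anti; rewrite !le.
move=> kuv a; rewrite {1}(Lreg a) fhom_sup; apply/fsup_leP => _ [x [c [xc ca]] <-].
have uvc : u x `&` v c = \bot.
  by apply: kd; rewrite fhom_meet -kuv -!fhom_meet xc !fhom_bot.
by rewrite -[u x]meetx1 -(fhom_top v) -ca fhom_join meetUr uvc join0x leIr.
Qed.

Definition compact_regular_frame (L : Frm) : Prop :=
  compact_frame L /\ regular_frame L.

Lemma CRegI_compact_regular (L : Frm) : compact_regular_frame (CRegI_functor L).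
Proof.
split; first exact: compact_creg (@compact_ideals _ L).
exact: creg_regular (@creg_completely_regular _ _).
Qed.

Lemma CRegI_lift (M L : Frm) : compact_regular_frame M ->
  forall f : arr M L, exists g : arr M (CRegI_functor L), CRegI_counit L \oc g = f.
Proof.
move=> [Mc Mreg] f; have Msc := compact_regular_stably_compact Mc Mreg.
exists (creg_lift (compact_regular_creg Mc Mreg)
  (frame_comp (ideal_map f) (way_below_hom Msc))).
(* Writing [a] as the join of the elements way below it reduces the claim to naturality of the join
   map. *)
apply: frame_hom_eq => a; rewrite -[RHS]/(fhom f a) -{2}(way_below_homK Msc a).
have /(congr1 (fun h : frame_hom (ideals M) L => h (way_below_hom Msc a))) :=
  naturality I_counit f.
by [].
Qed.

(** The counit is dense, because an ideal with bottom join contains only the bottom; [dense_hom_inj]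
    then applies. *)
Lemma CRegI_lift_uniq (M L : Frm) : compact_regular_frame M ->
  forall g g' : arr M (CRegI_functor L),
  CRegI_counit L \oc g = CRegI_counit L \oc g' -> g = g'.
Proof.
move=> [_ Mreg] g g' gg'; apply: (dense_hom_inj (k := CRegI_counit L)) => //.
  move=> [J Jreg] J0; apply: creg_eq.
  have {}J0 : fsup (iset J) = \bot by [].
  rewrite [RHS](fhom_bot (creg_incl (ideals L))).
  apply: ideals_eq; apply/seteqP; split=> x.
    move=> /(fsup_ub (iset J)); rewrite J0 lex0 => /eqP ->.
    by case: (isetP (\bot : ideals L)).
  by have /ideals_leP := le0x J; apply.
move=> x; exact: (congr1 (fun h : frame_hom M L => h x) gg').
Qed.

Lemma compact_regular_iso (L M : Frm) (h : arr L M) :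
  is_iso h -> compact_regular_frame L -> compact_regular_frame M.
Proof.
move=> [g [gh hg]] [Lc Lreg].
have hK : cancel (h : frame_hom L M) (g : frame_hom M L).
  by move=> x; apply: (congr1 (fun k : frame_hom L L => k x) gh).
have gK : cancel (g : frame_hom M L) (h : frame_hom L M).
  by move=> x; apply: (congr1 (fun k : frame_hom M M => k x) hg).
split; last exact: iso_regular gK Lreg.
rewrite /compact_frame -(fhom_top (h : frame_hom L M)).
exact: iso_proper hK gK _ _ Lc.
Qed.

(** * Spaces and spectra *)

Section Topology.
Variable X : topologicalType.
Implicit Types (A B : opens X) (x y : X).

(** If an ideal [J] covers [B] but omits [A], the sets [K] minus a member of [J] generate a proper
    filter. Its cluster point in [K] lies in some member of [J], which is absurd. *)
Lemma compact_between_way_below A B (K : set X) : compact K ->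
  (oset A `<=` K)%classic -> (K `<=` oset B)%classic -> way_below A B.
Proof.
move=> Kc AK KB; apply/way_belowP => J /opens_leP BJ; apply: contrapT => JA.
have [J0 Jd Jj] := isetP J.
pose F := filter_from (iset J) (fun U => K `\` oset U)%classic.
have FF : ProperFilter F.
  apply: filter_from_proper.
    apply: filter_from_filter; first by exists \bot.
    move=> U V JU JV; exists (U `|` V); first exact: Jj.
    by rewrite oset_join setDUr.
  move=> U JU; apply: contrapT => /nonemptyPn/seteqP[KU _]; apply: JA.
  apply: Jd JU; apply/opens_leP => x /AK Kx.
  by apply: contrapT => Ux; apply: (KU x).
have [|x [Kx xF]] := Kc F FF.
  by exists \bot => // x [].
have [U JU Ux] := BJ _ (KB _ Kx).
have [||y [[_ Uy] /Uy//]] := xF (K `\` oset U)%classic (oset U).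
  by exists U.
by apply: open_nbhs_nbhs; split=> //; apply: osetP.
Qed.

Lemma compact_opens : compact [set: X] -> compact_frame (opens X).
Proof.
by move=> Xc; apply: (compact_between_way_below Xc); rewrite oset_top.
Qed.

Lemma stably_compact_opens :
  stably_compact_space X -> stably_compact_frame (opens X).
Proof.
move=> [_ Xlc _ Xs]; split=> // A; apply: le_anti; apply/andP; split; last first.
  by apply/fsup_leP => B; apply: way_below_le.
apply/opens_leP => x Ax; have [|K [xK KA Kc]] := Xlc x (oset A).
  by apply: open_nbhs_nbhs; split=> //; apply: osetP.
exists (Opens (@open_interior _ K)) => //.
by apply: compact_between_way_below KA => //; apply: interior_subset.
Qed.

Lemma closure1P x A : ((oset A `&` closure [set x]) !=set0)%classic <-> oset A x.
Proof.
split=> [[y [Ay yx]]|Ax]; last by exists x; split=> //; apply: subset_closure.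
have [|z [-> //]] := yx (oset A).
by apply: open_nbhs_nbhs; split=> //; apply: osetP.
Qed.

Lemma irreducible_closure1 x : irreducible_closed (closure [set x]).
Proof.
split; first exact: closed_closure.
  by exists x; apply: subset_closure.
move=> B D cB cD BD; have [] := BD x (subset_closure (erefl x)) => [Bx|Dx].
  by left; rewrite closureE; apply: smallest_sub => // _ ->.
by right; rewrite closureE; apply: smallest_sub => // _ ->.
Qed.

Lemma O_Sigma_unitP x A : O_Sigma_unit X x A <-> oset A x.
Proof. by split=> /asboolP. Qed.

Section Sober.
Hypothesis Xsober : sober X.

(** Points with the same open neighbourhoods have the same closure, and sobriety makes generic
    points unique. *)
Lemma O_Sigma_unit_inj : injective (O_Sigma_unit X).
Proof.
move=> x y xy; have xyA A : oset A x <-> oset A y.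
  by rewrite -!O_Sigma_unitP xy.
have [z [_ zu]] := Xsober (irreducible_closure1 x).
rewrite -(zu x) // -(zu y) //.
suff le u v : (forall A, oset A u -> oset A v) ->
    (closure [set u] `<=` closure [set v])%classic.
  by apply/seteqP; split; apply: le => A; rewrite xyA.
move=> uv w uw U; rewrite nbhsE => -[V [oV Vw] VU].
have [|_ [-> Vu]] := uw V; first exact: open_nbhs_nbhs.
by exists v; split=> //; apply: VU; apply: (uv (Opens oV)).
Qed.

(** [W] is the largest open set sent to false. Preservation of meets makes its complement
    irreducible, and the generic point of that complement induces [f]. *)
Lemma O_Sigma_unit_surj (f : spectrum (opens X)) : exists x, O_Sigma_unit X x = f.
Proof.
pose h : frame_hom (opens X) bool := f.
pose W : opens X := fsup [set A | ~~ h A].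
have hW : ~~ h W.
  by rewrite fhom_sup; apply/asboolPn => -[A /negPf /= ->].
have leW A : ~~ h A <-> (oset A `<=` oset W)%classic.
  split=> [hA|/opens_leP AW]; first by apply/opens_leP; apply: fsup_ub.
  by apply: contra hW => hA; have := fhom_le h AW; rewrite hA; case: (h W).
have Wirr : irreducible_closed (~` oset W)%classic.
  split; first by apply: open_closedC; apply: osetP.
    apply: contrapT => /nonemptyPn; rewrite -setCT => /setC_inj W1.
    by move/negP: hW; apply; rewrite (_ : W = \top) ?fhom_top //;
      apply: opens_eq; rewrite W1 oset_top.
  move=> B D cB cD BD.
  pose B' := Opens (closed_openC cB); pose D' := Opens (closed_openC cD).
  have : ~~ h (B' `&` D').
    apply/leW => x [Bx Dx]; apply: contrapT => Wx.
    by have [] := BD x Wx.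
  rewrite fhom_meet negb_and => /orP[] /leW H; [left|right] => x Wx;
    by apply: contrapT => Bx; apply: Wx; apply: H.
have [x [Wx _]] := Xsober Wirr; exists x; apply: frame_hom_eq => A.
apply/idP/idP => [/O_Sigma_unitP Ax|hA].
  apply: contrapT => /negP/leW AW.
  have /closure1P : oset A x by [].
  by rewrite -Wx => -[y [Ay]]; apply; apply: AW.
apply/O_Sigma_unitP/closure1P; rewrite -Wx; apply: contrapT => /nonemptyPn AW.
move/negP: hA; apply; apply/negPn/leW => y Ay; apply: contrapT => Wy.
by rewrite -[False]/(set0 y) -AW.
Qed.

Lemma O_Sigma_unit_iso : is_iso (C := Top) (O_Sigma_unit X : @arr Top X _).
Proof.
pose g f := sval (cid (O_Sigma_unit_surj f)).
have gK : cancel g (O_Sigma_unit X).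
  by move=> f; apply: (svalP (cid (O_Sigma_unit_surj f))).
have gc : continuous g.
  apply/continuousP => A oA; exists (Opens oA) => //.
  have AP f : spec_open (Opens oA) f <-> A (g f).
    by rewrite -{1}[f]gK; apply: O_Sigma_unitP.
  by apply/seteqP; split=> f /AP.
exists (mkcts gc : @arr Top _ X); split; apply/continuousEP => z /=; last exact: gK.
by apply: O_Sigma_unit_inj; apply: gK.
Qed.
End Sober.
End Topology.

Lemma opens_mapK (X Y : Top) (f : arr X Y) (g : arr Y X) :
  f \oc g = id_arr Y -> cancel (opens_map f) (opens_map g).
Proof.
move=> fg A; apply: opens_eq; apply/seteqP; split=> y /=.
  by rewrite -[f (g y)]/((f \oc g : continuousType Y Y) y) fg.
by rewrite -[f (g y)]/((f \oc g : continuousType Y Y) y) fg.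
Qed.

Lemma homeo_proper (X Y : Top) (f : arr X Y) (g : arr Y X) :
  g \oc f = id_arr X -> f \oc g = id_arr Y -> proper_map f.
Proof.
by move=> gf fg; apply: iso_proper (opens_mapK fg) (opens_mapK gf).
Qed.

Lemma point_le d (L : frameType d) (f : frame_hom L bool) (a b : L) :
  a <= b -> f a -> f b.
Proof. by move=> /(fhom_le f); case: (f a); case: (f b). Qed.

(** * The spectrum of a frame *)

Section Spectrum.
Context {d : Order.disp_t} (L : frameType d).

(** The generic point sends [a] to whether [A] meets [spec_open a]; irreducibility makes this
    preserve meets. *)
Lemma spectrum_sober : sober (spectrum L).
Proof.
move=> A [cA A0 Airr].
pose h (a : L) : bool := `[< (A `&` spec_open a !=set0)%classic >].
have h_sub a : ~ h a -> (A `<=` ~` spec_open a)%classic.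
  by move=> ha f Af fa; apply: ha; apply/asboolP; exists f.
have hM a b : h (a `&` b) = h a `&` h b.
  apply/idP/idP => [/asboolP[f []]|].
    rewrite spec_open_meet => Af [fa fb].
    by apply/andP; split; apply/asboolP; exists f.
  move=> /andP[ha hb]; apply: contrapT => /h_sub.
  rewrite spec_open_meet setCI => /Airr[].
  - by apply: open_closedC; exists a.
  - by apply: open_closedC; exists b.
  - by have /asboolP[f [Af fa]] := ha => /(_ f Af).
  - by have /asboolP[f [Af fb]] := hb => /(_ f Af).
have hS (S : set L) : h (fsup S) = fsup (h @` S).
  apply/idP/asboolP => [/asboolP[f [Af]]|[a Sa /asboolP[f [Af fa]]]].
    by rewrite spec_open_sup => -[a Sa fa]; exists a => //; apply/asboolP; exists f.
  by apply/asboolP; exists f; split=> //; rewrite spec_open_sup; exists a.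
have h1 : h \top = \top.
  by apply/asboolP; rewrite spec_open_top setIT.
pose x : spectrum L := @FrameHom _ _ L bool h h1 hM hS.
have closureP (f g : spectrum L) : closure [set f] g <->
    (forall a, spec_open a g -> spec_open a f).
  split=> [fg a ga|gf U].
    have [|_ [-> //]] := fg (spec_open a).
    by apply: open_nbhs_nbhs; split=> //; exists a.
  rewrite nbhsE => -[_ [[a _ <-] ga] aU]; exists f; split=> //.
  by apply: aU; apply: gf.
have clx : A = closure [set x].
  apply/seteqP; split=> f.
    by move=> Af; apply/closureP => a fa; apply/asboolP; exists f.
  move=> /closureP fx; apply: cA => U; rewrite nbhsE => -[_ [[a _ <-] fa] aU].
  by have /asboolP[g [Ag ga]] := fx _ fa; exists g; split=> //; apply: aU.
exists x; split=> // y; rewrite clx => xy; apply: frame_hom_eq => a.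
have /closureP yx : closure [set y] x by rewrite -xy; apply: subset_closure.
have /closureP xy' : closure [set x] y by rewrite xy; apply: subset_closure.
by apply/idP/idP => [/yx|/xy'].
Qed.

Hypothesis Lsc : stably_compact_frame L.
Let Lcont : forall a, a = fsup [set x | way_below x a] := Lsc.2.

(* The compact saturated set of the Scott-open filter [{y | x << y}]. *)
Let above (x : L) : set (spectrum L) :=
  [set f : spectrum L | forall y, way_below x y -> (f : frame_hom L bool) y].

(** An ultrafilter on [above x] traces a prime filter on [L]. By interpolation the associated point
    lies in [above x], and the ultrafilter converges to it. *)
Let above_compact x : compact (above x).
Proof.
rewrite compact_ultra => F FU Fx; pose p a := F (spec_open a).
have pP : is_prime_filter p.
  split; last first.
    move=> a b; rewrite /p -fsup2 spec_open_sup bigcup_setU !bigcup_set1 => Fab.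
    have [|Fa] := in_ultra_setVsetC (spec_open a) FU; [by left|right].
    by apply: filterS2 Fab Fa => f [].
  split.
    split=> [|a b ab|a b Fa Fb]; rewrite /p.
    - by rewrite spec_open_top; apply: filterT.
    - by apply: filterS => f /= fa; apply: (point_le (f := f) ab fa).
    - by rewrite spec_open_meet; apply: filterI.
  by rewrite /p => /filter_ex[f]; rewrite /spec_open /= fhom_bot.
exists (prime_filter_point Lsc pP : spectrum L); split.
  move=> y /(way_below_interpolation Lcont)[z xz zy].
  apply/prime_filter_pointP; exists z => //.
  by apply: filterS Fx => f; apply.
move=> U; rewrite nbhsE => -[_ [[a _ <-] /prime_filter_pointP[y ya py]] aU].
apply: filterS py => f fy; apply: aU.
exact: (point_le (f := f) (way_below_le ya) fy).
Qed.

Lemma spectrum_compact : compact [set: spectrum L].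
Proof.
rewrite (_ : setT = above \top) //; apply/seteqP; split=> // f _ y.
move=> /way_below_le; rewrite le1x => /eqP ->.
by rewrite fhom_top.
Qed.

(** By continuity a point true at [a] is true at some [x] way below [a], and [above x] lies between
    [spec_open x] and [spec_open a]. *)
Lemma spectrum_compact_nbhs : has_compact_nbhs_bases (spectrum L).
Proof.
move=> f U; rewrite nbhsE => -[_ [[a _ <-] fa] aU].
have [x xa fx] : exists2 x, way_below x a & (f : frame_hom L bool) x.
  move: fa; rewrite /spec_open /= {1}(Lcont a) fhom_sup => /asboolP[x xa fx].
  by exists x.
exists (above x); split; last exact: above_compact.
  exists (spec_open x); first by split=> //; exists x.
  by move=> g gx y /way_below_le xy; apply: (point_le (f := g) xy gx).
by move=> g /(_ a xa) ga; apply: aU.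
Qed.

(** Surjectivity is the definition of the topology; injectivity is spatiality. *)
Lemma O_Sigma_counit_inverse : exists g : frame_hom (opens (spectrum L)) L,
  cancel (O_Sigma_counit L) g /\ cancel g (O_Sigma_counit L).
Proof.
apply: frame_hom_bij => [a b ab|[U oU]]; last first.
  by have [a _ aU] := oU; exists a; apply: opens_eq.
have {}ab : spec_open a = spec_open b by apply: (congr1 (@oset _) ab).
suff le (u v : L) : spec_open u = spec_open v -> u <= v.
  by apply: le_anti; rewrite !le.
move=> uv; case: (boolP (u <= v)) => // /(point_separation Lsc)[f fu].
suff -> : f v by [].
by rewrite -[is_true _]/(spec_open v f) -uv.
Qed.

Lemma stably_compact_spectrum : stably_compact_space (spectrum L).
Proof.
split; [exact: spectrum_compact|exact: spectrum_compact_nbhs|exact: spectrum_sober|].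
have [g [hK gK]] := O_Sigma_counit_inverse.
have [[_ wt wm _] _] := Lsc.
apply: way_below_sublatticeP.
  by rewrite -(fhom_top (O_Sigma_counit L)); apply: (iso_proper hK gK).
move=> A B A' B' /(iso_proper gK hK) AB /(iso_proper gK hK) AB'.
rewrite -[A `&` A']gK -[B `&` B']gK; apply: (iso_proper hK gK).
by rewrite !fhom_meet; apply: wm.
Qed.
End Spectrum.

(** If [f] is true and [g] false at [a], then [f] is true at some [x] rather below [a], and [g] is
    true at the witness [c], which is disjoint from [x]. *)
Lemma spectrum_hausdorff d (L : frameType d) :
  regular_frame L -> hausdorff_space (spectrum L).
Proof.
move=> Lreg.
have sep (f g : spectrum L) a : spec_open a f -> ~ spec_open a g ->
    exists x c : L, [/\ spec_open x f, spec_open c g & x `&` c = \bot].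
  rewrite /spec_open /= {1}(Lreg a) fhom_sup => /asboolP[x [c [xc ca]] fx] ga.
  exists x, c; split=> //; have := fhom_top (g : frame_hom L bool).
  by rewrite -ca fhom_join => /orP[].
have disj (x c : L) :
    x `&` c = \bot -> (spec_open x `&` spec_open c == set0)%classic.
  move=> xc; rewrite -spec_open_meet xc; apply/eqP/seteqP; split=> // f.
  by rewrite /spec_open /= fhom_bot.
have spo (x : L) : open (spec_open x) by exists x.
rewrite open_hausdorff => f g fg.
have [a fga] : exists a, (f : frame_hom L bool) a != (g : frame_hom L bool) a.
  apply: contrapT => H; move/eqP: fg; apply; apply: frame_hom_eq => a.
  by apply: contrapT => /eqP fga; apply: H; exists a.
case fa: ((f : frame_hom L bool) a); case ga: ((g : frame_hom L bool) a);
  rewrite fa ga // in fga.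
- have [||x [c [fx gc xc]]] := sep f g a; rewrite /spec_open /= ?ga //.
  exists (spec_open x, spec_open c) => /=; first by split; apply/mem_set.
  by split=> //; apply: disj.
- have [||x [c [gx fc xc]]] := sep g f a; rewrite /spec_open /= ?fa //.
  exists (spec_open c, spec_open x) => /=; first by split; apply/mem_set.
  by split=> //; rewrite setIC; apply: disj.
Qed.

(** * Compact Hausdorff spaces *)

Section CompactHausdorff.
Variable X : topologicalType.
Hypotheses (Xc : compact [set: X]) (Xh : hausdorff_space X).

Let closed_nbhs (x : X) (U : set X) : nbhs x U ->
  exists2 B, nbhs x B & (closure B `<=` U)%classic.
Proof.
have xT : nbhs x [set: X] by apply: filterT.
by have /(_ U) := compact_regular Xh Xc xT.
Qed.

Lemma compact_hausdorff_regular : regular_frame (opens X).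
Proof.
move=> A; apply: le_anti; apply/andP; split; last first.
  by apply/fsup_leP => B; apply: rather_below_le.
apply/opens_leP => x Ax; have [|B xB BA] := closed_nbhs (x := x) (U := oset A).
  by apply: open_nbhs_nbhs; split=> //; apply: osetP.
exists (Opens (@open_interior _ B)) => //.
(* The complement of the closure of [B] witnesses that the interior of [B] is rather below [A]. *)
exists (Opens (closed_openC (@closed_closure _ B))); split; apply: opens_eq.
  rewrite oset_meet oset_bot; apply/seteqP; split=> // y [By]; apply.
  by apply: subset_closure; apply: interior_subset.
rewrite oset_join oset_top; apply/seteqP; split=> // y _.
by have [/BA|] := pselect (closure B y); [right|left].
Qed.

(** Disjoint open neighbourhoods of two points have complements covering the space. An irreducible
    set lies in one of these, so it cannot contain both points. *)
Lemma hausdorff_sober : sober X.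
Proof.
have cl1 (x : X) : closure [set x] = [set x].
  apply/esym/closure_id; apply: accessible_closed_set1.
  exact: hausdorff_accessible.
move=> A [cA [x Ax] Airr]; exists x; split; last first.
  by move=> y; rewrite cl1 => Ay; move: Ax; rewrite Ay.
rewrite cl1; apply/seteqP; split=> [y Ay|_ -> //].
apply: contrapT => /eqP yx; have := Xh; rewrite open_hausdorff => /(_ _ _ yx).
move=> [[U V] /= [/set_mem Uy /set_mem Vx] [oU oV /eqP UV]].
have [] := Airr _ _ (open_closedC oU) (open_closedC oV).
- by rewrite -setCI UV setC0.
- by move/(_ y Ay).
- by move/(_ x Ax).
Qed.

Lemma compact_hausdorff_stably_compact : stably_compact_space X.
Proof.
split=> //; last first.
- apply: (compact_regular_stably_compact _ _).1.
    exact: compact_opens.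
  exact: compact_hausdorff_regular.
- exact: hausdorff_sober.
- move=> x U /closed_nbhs[B xB BU]; exists (closure B); split=> //.
    by apply: filterS xB; apply: subset_closure.
  by apply: subclosed_compact Xc _ => //; apply: closed_closure.
Qed.
End CompactHausdorff.

(** * The Čech–Stone reflection *)

Definition compact_hausdorff (X : Top) : Prop :=
  compact [set: X] /\ hausdorff_space X.

Lemma compact_image (X Y : topologicalType) (f : X -> Y) :
  continuous f -> (forall y, exists x, f x = y) ->
  compact [set: X] -> compact [set: Y].
Proof.
move=> fc fs Xc; rewrite (_ : setT = f @` setT).
  by apply: continuous_compact => //; apply: continuous_subspaceT.
by apply/seteqP; split=> // y _; have [x <-] := fs y; exists x.
Qed.

Lemma hausdorff_inj (X Y : topologicalType) (f : X -> Y) :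
  continuous f -> injective f -> hausdorff_space Y -> hausdorff_space X.
Proof.
move=> fc finj; rewrite !open_hausdorff => Yh x y xy.
have [|[U V] /= [/set_mem Ux /set_mem Vy] [oU oV /eqP UV]] := Yh (f x) (f y).
  by apply: contra xy => /eqP/finj ->.
exists (f @^-1` U, f @^-1` V)%classic => /=; first by split; apply/mem_set.
split; [by apply: (continuousP _).1|by apply: (continuousP _).1|].
by rewrite -preimage_setI UV preimage_set0.
Qed.

Lemma compact_hausdorff_iso (X Y : Top) (f : arr X Y) :
  is_iso f -> compact_hausdorff X -> compact_hausdorff Y.
Proof.
move=> [g [gf fg]] [Xc Xh].
have gK (y : Y) : (f : continuousType X Y) ((g : continuousType Y X) y) = y.
  by rewrite -[LHS]/((f \oc g : continuousType Y Y) y) fg.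
split; last first.
  apply: (@hausdorff_inj Y X (g : continuousType Y X)) => //.
    exact: cts_fun.
  exact: can_inj gK.
apply: (@compact_image X Y (f : continuousType X Y)) => //; first exact: cts_fun.
by move=> y; exists ((g : continuousType Y X) y).
Qed.

(** An ultrafilter converges to the prime filter of those [A] whose basic open set it contains. *)
Lemma opf_compact (X : topologicalType) : compact [set: open_prime_filter X].
Proof.
rewrite compact_ultra => F FU _; pose p A := F (opf_basic A).
have pP : is_prime_filter p.
  split; last first.
    move=> A B; rewrite /p => FAB.
    have [|FA] := in_ultra_setVsetC (opf_basic A) FU; [by left|right].
    by apply: filterS2 FAB FA => q; case: (opfsetP q) => _ qp /qp[|].
  split; last first.
    by rewrite /p => /filter_ex[q]; case: (opfsetP q) => -[].
  split=> [|A B AB|A B FA FB]; rewrite /p.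
  - by rewrite opf_basic_top; apply: filterT.
  - by apply: filterS => q; case: (opfsetP q) => -[[_ up _] _] _; apply: up.
  - by rewrite opf_basic_meet; apply: filterI.
exists (OpenPrimeFilter pP); split=> // U.
rewrite nbhsE => -[_ [[S _ <-] [A SA pA]] SU].
by apply: filterS pA => q qA; apply: SU; exists A.
Qed.

Lemma RF_compact_hausdorff (X : Top) : compact_hausdorff (RF_functor X).
Proof.
split; last exact: haus_quot_hausdorff.
apply: compact_image (@haus_pi_continuous _) _ (@opf_compact X) => z.
by have [x ->] := haus_pi_surj z; exists x.
Qed.

(** * Limits of open prime filters and the extension property *)

Section Limit.
Variables (X : topologicalType) (Xsc : stably_compact_frame (opens X)).

Let limit_fun (p : open_prime_filter X) : spectrum (opens X) :=
  prime_filter_point Xsc (opfsetP p).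

Let limit_fun_continuous : continuous limit_fun.
Proof.
(* The preimage of [spec_open A] is the union of the basic open sets of all [B] way below [A]. *)
apply/continuousP => _ [A _ <-]; exists [set B | way_below B A] => //.
apply/seteqP; split=> p.
  by move=> [B BA pB]; apply/prime_filter_pointP; exists B.
by move=> /prime_filter_pointP[B BA pB]; exists B.
Qed.

Definition opf_limit :
  continuousType (open_prime_filter X) (spectrum (opens X)) :=
  mkcts limit_fun_continuous.

Lemma opf_limit_unit x : opf_limit (opf_unit X x) = O_Sigma_unit X x.
Proof.
apply: frame_hom_eq => A; apply/idP/idP => [/prime_filter_pointP[B BA Bx]|].
  by apply/O_Sigma_unitP; have /opens_leP := way_below_le BA; apply.
move=> /O_Sigma_unitP Ax; apply/prime_filter_pointP.
by move: Ax; rewrite {1}(Xsc.2 A) oset_sup => -[B BA Bx]; exists B.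
Qed.
End Limit.

Lemma RF_extension (X Y : Top) : compact_hausdorff Y ->
  forall f : arr X Y, exists g : arr (RF_functor X) Y, g \oc RF_unit X = f.
Proof.
move=> [Yc Yh] f.
have Ysc := compact_hausdorff_stably_compact Yc Yh.
have [_ _ Ysob _] := Ysc; have [h [hK _]] := O_Sigma_unit_iso Ysob.
(* Push a prime filter forward to [Y], take its limit in the spectrum of the opens, and return to
   [Y] by sobriety. *)
pose k : @arr Top (open_prime_filter X) Y :=
  h \oc (opf_limit (stably_compact_opens Ysc) : @arr Top _ _)
    \oc fun_arr F_functor f.
exists (refl_ext Hausdorff_reflection Yh k).
rewrite -[RF_unit X]/(refl_unit Hausdorff_reflection (F_functor X) \oc F_unit X).
rewrite compmA refl_extE -compmA -[_ \oc F_unit X](naturality F_unit f).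
apply/continuousEP => x.
rewrite -[LHS]/((h : continuousType _ _) (opf_limit _ (opf_unit Y (f x)))).
rewrite opf_limit_unit.
rewrite -[LHS]/((h \oc (O_Sigma_unit Y : @arr Top _ _)
  : continuousType Y Y) (f x)).
by rewrite hK.
Qed.

(** Members of a prime filter are nonempty, so the neighbourhood filters are dense in [F X]; maps
    into a Hausdorff space agreeing on them agree on [F X], hence on its quotient. *)
Lemma RF_extension_uniq (X Y : Top) : compact_hausdorff Y ->
  forall g g' : arr (RF_functor X) Y,
  g \oc RF_unit X = g' \oc RF_unit X -> g = g'.
Proof.
move=> [_ Yh] g g' gg'.
pose u (g : arr (RF_functor X) Y) (p : open_prime_filter X) : Y :=
  (g : continuousType _ _) (haus_pi p).
have uc (k : arr (RF_functor X) Y) : continuous (u k).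
  move=> p; apply: continuous_comp; first exact: haus_pi_continuous.
  exact: cts_fun.
have ux x : u g (opf_unit X x) = u g' (opf_unit X x).
  by rewrite -[LHS]/((g \oc RF_unit X : continuousType X Y) x) gg'.
apply/continuousEP => z; have [p ->] := haus_pi_surj z.
rewrite -[LHS]/(u g p) -[RHS]/(u g' p).
apply: contrapT => /eqP up; move: Yh; rewrite open_hausdorff => /(_ _ _ up).
move=> [[U V] /= [/set_mem Up /set_mem Vp] [oU oV /eqP UV]].
have [S _ SU] : open (u g @^-1` U)%classic by apply: (continuousP _).1.
have [S' _ SV] : open (u g' @^-1` V)%classic by apply: (continuousP _).1.
have [A SA pA] : (\bigcup_(A in S) opf_basic A)%classic p by rewrite SU.
have [B SB pB] : (\bigcup_(A in S') opf_basic A)%classic p by rewrite SV.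
have [[[_ _ pm] p0] _] := opfsetP p.
have [x [Ax Bx]] : exists x, oset (A `&` B) x.
  apply: contrapT => AB; apply: p0; rewrite (_ : \bot = A `&` B); first exact: pm.
  apply: opens_eq; rewrite oset_bot; apply/seteqP; split=> // x ABx.
  by apply: AB; exists x.
have Ux : (u g @^-1` U)%classic (opf_unit X x) by rewrite -SU; exists A.
have Vx : (u g' @^-1` V)%classic (opf_unit X x) by rewrite -SV; exists B.
by rewrite -[False]/(set0 (u g (opf_unit X x))) -UV; split=> //; rewrite ux.
Qed.

(** * The dual equivalences *)

Lemma O_maps_StK : maps_sub O_functor StKSp (op_sub StKFrm).
Proof. by split=> // X; apply: stably_compact_opens. Qed.

Lemma Sigma_maps_StK : maps_sub Sigma_functor (op_sub StKFrm) StKSp.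
Proof.
split=> [L|M L h /= Msc Lsc hp]; first exact: stably_compact_spectrum.
have [g [gK hK]] := O_Sigma_counit_inverse Lsc.
have [g' [gK' hK']] := O_Sigma_counit_inverse Msc.
move=> A B AB.
(* Through the counit isomorphisms, the inverse image map of [spec_map h] is conjugate to [h]. *)
have hE C : opens_map (spec_map h) C = O_Sigma_counit M (h (g C)).
  by rewrite -{1}[C]hK; apply: opens_eq.
rewrite !hE; apply: (iso_proper gK' hK'); apply: hp.
exact: (iso_proper hK gK).
Qed.

Section ConcreteAdjunction.

Let eta_nat (X Y : Top) (f : arr X Y) :
  (O_Sigma_unit Y : @arr Top _ _) \oc f
  = fun_arr (Sigma_functor \of O_functor) f \oc O_Sigma_unit X.
Proof. by apply/continuousEP => x; apply: frame_hom_eq. Qed.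

Let eps_nat (L M : op_cat Frm) (f : arr L M) :
  (O_Sigma_counit M : @arr (op_cat Frm) _ _)
    \oc fun_arr (O_functor \of Sigma_functor) f
  = f \oc (O_Sigma_counit L : @arr (op_cat Frm) _ _).
Proof. by apply: frame_hom_eq => a; apply: opens_eq. Qed.

(* [O_Sigma_adjunction] is stuck on the opaque [ssr_have_upoly], so its unit
   and counit are only reached through uniqueness of adjunctions, by comparison
   with this one. *)
Definition concrete_adjunction : adjunction O_functor Sigma_functor.
Proof.
refine (@Adjunction _ _ _ _
  (@NatTrans Top Top (id_functor Top) (Sigma_functor \of O_functor)
    (fun X => O_Sigma_unit X) eta_nat)
  (@NatTrans (op_cat Frm) (op_cat Frm) (O_functor \of Sigma_functor)
    (id_functor (op_cat Frm)) (fun L : Frm => O_Sigma_counit L) eps_nat) _ _).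
- move=> X; apply: frame_hom_eq => A; apply: opens_eq.
  by apply/seteqP; split=> x /=; rewrite /spec_open /= => /asboolP.
- move=> L; apply/continuousEP => f; apply: frame_hom_eq => a /=.
  by rewrite /spec_open /=; apply/asboolP/idP.
Defined.
End ConcreteAdjunction.

(** Generic in [S] to serve both equivalences: a homeomorphism and its inverse are proper, hence
    arrows of every such [S]. *)
Lemma O_Sigma_unit_sub_iso (S : subcategory Top) :
  (forall X, sub_ob S X -> sober X) ->
  (forall (X Y : Top) (f : arr X Y), proper_map f -> sub_hom S f) ->
  forall X, sub_ob S X -> sub_iso S (adj_unit O_Sigma_adjunction X).
Proof.
move=> Ssober Sproper X /Ssober /O_Sigma_unit_iso Xiso.
have [|g [gf fg]] :=
    @adj_unit_is_iso _ _ _ _ concrete_adjunction O_Sigma_adjunction X.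
  exact: Xiso.
split; first exact/Sproper/(homeo_proper gf fg).
by exists g; split=> //; apply/Sproper/(homeo_proper fg gf).
Qed.

Lemma frame_iso_proper (L M : Frm) (h : arr L M) (g : arr M L) :
  g \oc h = id_arr L -> h \oc g = id_arr M -> proper_frame_hom h.
Proof.
move=> gh hg; apply: (@iso_proper _ _ L M h g) => x.
  exact: (congr1 (fun k : frame_hom L L => k x) gh).
exact: (congr1 (fun k : frame_hom M M => k x) hg).
Qed.

(** The frame side of [O_Sigma_unit_sub_iso], with spatiality in place of sobriety. *)
Lemma O_Sigma_counit_sub_iso (S : subcategory Frm) :
  (forall L, sub_ob S L -> stably_compact_frame L) ->
  (forall (L M : Frm) (h : arr L M), proper_frame_hom h -> sub_hom S h) ->
  forall L, sub_ob S L -> sub_iso (op_sub S) (adj_counit O_Sigma_adjunction L).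
Proof.
move=> Ssc Sproper L /Ssc /O_Sigma_counit_inverse[g [hK gK]].
have [|k [kh hk]] :=
    @adj_counit_is_iso _ _ _ _ concrete_adjunction O_Sigma_adjunction L.
  by exists g; split; apply: frame_hom_eq.
split; first exact/Sproper/(frame_iso_proper hk kh).
by exists k; split=> //; apply/Sproper/(frame_iso_proper kh hk).
Qed.

Lemma O_maps_KHaus : maps_sub O_functor KHaus (op_sub KRegFrm).
Proof.
split=> // X [Xc Xh]; split; first exact: compact_opens.
exact: compact_hausdorff_regular.
Qed.

Lemma Sigma_maps_KReg : maps_sub Sigma_functor (op_sub KRegFrm) KHaus.
Proof.
split=> // L [Lc Lreg]; split; last exact: spectrum_hausdorff.
exact: spectrum_compact (compact_regular_stably_compact Lc Lreg).
Qed.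

Theorem proposition25 :
  boolean_ultrafilter_theorem ->
  [/\ restricts_to_equivalence O_Sigma_adjunction StKSp (op_sub StKFrm),
      subcategory_of KHaus StKSp /\ subcategory_of KRegFrm StKFrm,
      restricts_to_equivalence O_Sigma_adjunction KHaus (op_sub KRegFrm),
      exists M : monad RF_unit,
        idempotent_monad M /\ iso_over (alg_forget M) (sub_incl KHaus) &
      exists W : comonad CRegI_counit,
        idempotent_comonad W /\ iso_over (coalg_forget W) (sub_incl KRegFrm)].
Proof.
move=> _.
have KReg_sc (L : Frm) : sub_ob KRegFrm L -> stably_compact_frame L.
  by move=> [Lc Lreg]; apply: compact_regular_stably_compact.
have KHaus_sc (X : Top) : sub_ob KHaus X -> stably_compact_space X.
  by move=> [Xc Xh]; apply: compact_hausdorff_stably_compact.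
split.
- apply: restricts_to_equivalence_of_iso O_maps_StK Sigma_maps_StK _ _.
    by apply: O_Sigma_unit_sub_iso => // X [].
  exact: O_Sigma_counit_sub_iso.
- split; split=> //.
    (* Continuous maps of compact Hausdorff spaces are proper because their frames of opens are
       compact regular. *)
    move=> X Y f [Xc Xh] [Yc Yh] _.
    apply: compact_regular_proper; rewrite //=; try exact: compact_opens.
    exact: compact_hausdorff_regular.
  by move=> L M h [Lc Lreg] [Mc _] _; apply: compact_regular_proper.
- apply: restricts_to_equivalence_of_iso O_maps_KHaus Sigma_maps_KReg _ _.
    by apply: O_Sigma_unit_sub_iso => // X /KHaus_sc[].
  exact: O_Sigma_counit_sub_iso.
- apply: reflective_monad.
  + exact: RF_compact_hausdorff.
  + exact: RF_extension.
  + exact: RF_extension_uniq.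
  + exact: compact_hausdorff_iso.
- apply: coreflective_comonad.
  + exact: CRegI_compact_regular.
  + exact: CRegI_lift.
  + by move=> M L PM; apply: CRegI_lift_uniq.
  + exact: compact_regular_iso.
Qed.
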